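(* Let Assumption (SL) (see context) hold with $\delta=\frac{d}{\alpha c}\in(0,1)$ and let $Z_n\stackrel{d}{=}Z_1(\lfloor n\,\cdot\rfloor)/b_n$. Then the following local limit theorem holds: for any $t>0$ and any sequence $(s_n)$ such that $ns_n\in\mathbb N$ and $s_n\to s\in(0,t)$, $$\mathbb P(g_t(Z_n)=s_n)\sim\frac1n\,\frac{1}{\Gamma(\delta)\Gamma(1-\delta)\,s^\delta(t-s)^{1-\delta}}\qquad\text{as }n\to\infty.$$
   Context: $\mathbb N=\{0,1,2,\dots\}$; $a_n\sim a_n'$ means $a_n/a_n'\to1$. $\mu,\nu$ are probability distributions on $\mathbb N$ (offspring and immigration laws) with $\mu(1)<1$ and $\nu(0)>0$; $f(s)=\sum_{n}s^n\mu(n)$, $g(s)=\sum_n s^n\nu(n)$. Assumption (SL): for $s\in(0,1)$, $f(s)=s+c(1-s)^{1+\alpha}\ell(1-s)$ and $g(s)=1-d(1-s)^\alpha k(1-s)$ for some constants $c,d>0$, $\alpha\in(0,1]$ and functions $\ell,k:(0,1)\to(0,\infty)$ slowly varying at $0$ with $\ell(s)/k(s)\to1$ as $s\to0$. Scaling sequence: $(b_n)$ is a sequence of positive reals, regularly varying with index $1/\alpha$, with $b_n^\alpha\sim n\,\ell(1/b_n)$. BGWI process: $Z_1=(Z_1(k))_{k\in\mathbb N}$ is the Markov chain on $\mathbb N$ with $Z_1(0)=0$ in which, given $Z_1(k)$, $Z_1(k+1)$ is the sum of $Z_1(k)$ i.i.d. variables of law $\mu$ plus an independent variable of law $\nu$.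 For a càdlàg path $w:[0,\infty)\to[0,\infty)$ with $w(0)=0$, $g_t(w)=\sup\{s\le t:w(s)=0\}$ (supremum over real $s\in[0,t]$; $Z_n$ is a piecewise constant continuous-time path). *)

(* Defs.v *)
From HB Require Import structures.
From mathcomp Require Export all_boot all_order all_algebra.
From mathcomp Require Export all_classical all_reals all_analysis.

Set Implicit Arguments.
Unset Strict Implicit.
Unset Printing Implicit Defensive.

Export Order.TTheory GRing.Theory Num.Theory.
Export numFieldNormedType.Exports.

Local Open Scope classical_set_scope.
Local Open Scope ring_scope.

Section Defs.
Context {R : realType}.
Implicit Types (mu nu : probability nat R) (l k : R -> R) (a b : nat -> R)
  (w : R -> R).

Definition Gamma (a : R) : R :=
  Rintegral (@lebesgue_measure R) `]0, +oo[ (fun x => x `^ (a - 1) * expR (- x)).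

Definition asymp_equiv a b := (fun n => a n / b n) @ \oo --> (1 : R).

Definition mass mu (n : nat) : R := fine (mu [set n]).

Definition genfun mu (s : R) : R := limn (series (fun n => s ^+ n * mass mu n)).

Definition slowly_varying_at0 l := forall lam, 0 < lam ->
  (fun x => l (lam * x) / l x) @ 0^'+ --> (1 : R).

Definition regularly_varying_seq (rho : R) b := forall lam, 0 < lam ->
  (fun n => b (Num.truncn (lam * n%:R)) / b n) @ \oo --> lam `^ rho.

Record assumption_SL mu nu (c d alpha : R) l k : Prop := AssumptionSL {
  SL_c_gt0 : 0 < c;
  SL_d_gt0 : 0 < d;
  SL_alpha : 0 < alpha <= 1;
  SL_l_gt0 : forall x, 0 < x < 1 -> 0 < l x;
  SL_k_gt0 : forall x, 0 < x < 1 -> 0 < k x;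
  SL_l_sv : slowly_varying_at0 l;
  SL_k_sv : slowly_varying_at0 k;
  SL_lk : (fun x => l x / k x) @ 0^'+ --> (1 : R);
  SL_offspring : forall s, 0 < s < 1 ->
    genfun mu s = s + c * (1 - s) `^ (1 + alpha) * l (1 - s);
  SL_immigration : forall s, 0 < s < 1 ->
    genfun nu s = 1 - d * (1 - s) `^ alpha * k (1 - s) }.

Record scaling_sequence (alpha : R) l b : Prop := ScalingSequence {
  scaling_gt0 : forall n, 0 < b n;
  scaling_rv : regularly_varying_seq alpha^-1 b;
  scaling_asymp :
    asymp_equiv (fun n => b n `^ alpha) (fun n => n%:R * l (b n)^-1) }.

Definition conv (p q : nat -> R) (j : nat) : R :=
  \sum_(i < j.+1) p i * q (j - i)%N.

(* mass at j of the law of xi_1 + ... + xi_i + eta with xi_1, ..., xi_i ~ mu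
   and eta ~ nu all independent *)
Definition bgwi_trans mu nu (i j : nat) : R :=
  iter i (conv (mass mu)) (mass nu) j.

(* The Markov property together with the transition law is expressed without
   conditioning on possibly null events, through the law of the trajectory. *)
Record is_BGWI d (T : measurableType d) (P : probability T R) mu nu
    (Z : nat -> T -> nat) : Prop := IsBGWI {
  BGWI_meas : forall n, measurable_fun setT (Z n);
  BGWI_init : P [set x | Z 0%N x = 0%N] = 1%E;
  BGWI_step : forall n (z : nat -> nat),
    fine (P [set x | forall i, (i <= n.+1)%N -> Z i x = z i]) =
    fine (P [set x | forall i, (i <= n)%N -> Z i x = z i]) *
      bgwi_trans mu nu (z n) (z n.+1) }.

Definition scaled_path (Z : nat -> nat) b (n : nat) : R -> R :=
  fun s => (Z (Num.truncn (n%:R * s)))%:R / b n.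

(* Paths on [0, +oo[ are represented by total functions R -> R whose values at
   negative times are irrelevant. *)
Definition path_sigma_algebra : set (set (R -> R)) :=
  <<s [set A | exists s (B : set R),
         [/\ 0 <= s, measurable B & A = [set w | B (w s)] ] ] >>.

Definition random_path d (T : measurableType d) (X : T -> R -> R) :=
  forall s, 0 <= s -> measurable_fun setT (fun x => X x s).

Definition same_law d (T : measurableType d) (P : probability T R)
    d' (T' : measurableType d') (P' : probability T' R)
    (X : T -> R -> R) (X' : T' -> R -> R) :=
  forall A, path_sigma_algebra A -> P (X @^-1` A) = P' (X' @^-1` A).

(* piecewise constant and right-continuous, with finitely many jumps on every
   compact interval *)
Definition step_path w :=
  (forall s, 0 <= s -> \forall u \near s^'+, w u = w s) /\
  (forall s, 0 < s -> exists v, \forall u \near s^'-, w u = v).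

(* g_t(w); by convention of sup it is 0 when w has no zero on [0, t], which has
   probability 0 for the processes considered. *)
Definition last_zero (t : R) w : R := sup [set s | 0 <= s <= t /\ w s = 0].

End Defs.

(* Main.v *)
(** Let u n be the probability that the chain is at 0 at time n and v r the
probability that it avoids 0 at times 1, ..., r after a visit to 0. By the
Markov property the chain has its last zero before time N at time k with
probability u k * v (N - k); with k + 1 = n s_n and N = floor(n t) this is the
probability of the theorem, and summing over k <= N gives the renewal equation
u * v = 1.

Explicitly u n = prod_(k < n) g (f^k 0). The function psi x = f (1 - x) - (1 - x)
is convex and regularly varying of index 1 + alpha, so with q_n = 1 - f^n 0 and
e_n = psi q_n / q_n one gets 1 / e_(n+1) - 1 / e_n --> alpha by comparing secants,
hence n e_n --> 1 / alpha and n (1 - u (n+1) / u n) --> delta.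

Let a_n(x) = prod_(k < n) (k + x) / (k + 1), so that a(x) * a(y) = a(x + y) and
a(1) = 1. Then L = u / a(1 - delta) is slowly varying. Pulling L out of the
renewal equation gives (a(1 - delta) * v) n ~ 1 / L n, and convolving with
a(delta) gives v 0 + ... + v n ~ a_n(1 + delta) / L n. As v is monotone,
v n ~ a_n(delta) / L n. In the product u k * v (N - k) the factors L cancel
asymptotically, and a_n(x) ~ n^(x - 1) / Gamma(x) yields the constant. *)

Require Import Defs.
From mathcomp Require Import all_boot all_order all_algebra.
From mathcomp Require Import all_classical all_reals all_analysis.
From mathcomp Require Import measurable_realfun.
From mathcomp Require Import ring lra.
Set Implicit Arguments.
Unset Strict Implicit.
Unset Printing Implicit Defensive.
Local Open Scope classical_set_scope.
Local Open Scope ring_scope.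

(** * The Gamma function and Gauss's product *)

Section Gamma_function.
Context {R : realType}.
Implicit Types a x y z : R.
Local Notation leb := (@lebesgue_measure R).

Local Notation integrand a := (fun y : R => (y `^ (a - 1) * expR (- y))%:E).

(** The renewal equation determines v only implicitly; besides it, v is known only to be
    nonincreasing. No Tauberian theorem is invoked: all comparisons are made on coefficients with
    the solvable pair u = a(1 - delta), v = a(delta), whose generating functions are powers of 1 -
    z, so that convolving with a(delta) takes the place of dividing generating functions. Slow
    variation is kept in uniform form because the factor pulled out of the second convolution is
    known only up to asymptotic equivalence, with no control on its increments. For the iterates of
    f, the assumption gives no derivative of l. Convexity of f makes secant slopes monotone, and
    slopes over intervals of fixed ratio are known from regular variation; this is all that the
    limit of n e_n requires. On the path side, laws agree only on the sigma-algebra generated by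
    coordinates, whereas the last zero is a supremum over uncountably many times. Restricted to
    right-continuous step paths, the event coincides with one that depends on countably many
    coordinates. *)

Lemma measurable_Gamma_integrand a D :
  measurable D -> measurable_fun D (integrand a).
Proof.
move=> mD; apply/measurable_EFinP; apply: measurable_funM.
  by apply: measurable_funTS; exact: measurable_powR.
by apply: measurable_funTS; exact: measurableT_comp.
Qed.

Lemma Gamma_integrand_ge0 a y : (0 <= (y `^ (a - 1) * expR (- y))%:E)%E.
Proof. by rewrite lee_fin mulr_ge0 ?powR_ge0 ?expR_ge0. Qed.

(** With extended real values, monotone limits and inequalities need no integrability; finiteness
    comes out at the end, in [eGamma_fin_num]. *)
Definition eGamma a : \bar R := (\int[leb]_(y in `]0%R, +oo[) (y `^ (a - 1) * expR (- y))%:E)%E.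

Lemma cvg_powR_expRN a : 0 < a ->
  (fun n : nat => n.+2%:R `^ a * expR (- n.+2%:R)) @ \oo --> (0 : R).
Proof.
move=> a0; set k := Num.truncn a.
have ak : a <= k.+1%:R by rewrite ltW// truncnS_gt.
apply: (@squeeze_cvgr _ _ _ _ (cst 0) (fun n => k.+2`!%:R / n.+1%:R)).
- near=> n; rewrite mulr_ge0 ?powR_ge0 ?expR_ge0//=.
  rewrite expRN ler_pdivrMr ?expR_gt0//.
  (* The degree k + 2 is one more than a <= k + 1 requires; the surplus factor gives the rate 1 / (n
     + 1). *)
  have h := expR_ge1Dxn k.+1 (ler0n R n.+2).
  have f0 : 0 < k.+2`!%:R :> R by rewrite ltr0n fact_gt0.
  apply: (@le_trans _ _ (k.+2`!%:R / n.+1%:R * (n.+2%:R ^+ k.+2 / k.+2`!%:R))).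
    apply: (@le_trans _ _ (n.+2%:R ^+ k.+1)).
      by rewrite -powR_mulrn// ler_powR// ler1n.
    have -> : k.+2`!%:R / n.+1%:R * (n.+2%:R ^+ k.+2 / k.+2`!%:R) = n.+2%:R / n.+1%:R * n.+2%:R ^+ k.+1 :> R.
      rewrite exprS; field; rewrite ?gt_eqF//.
    rewrite ler_peMl ?exprn_ge0// ler_pdivlMr// mul1r ler_nat//.
  rewrite ler_wpM2l ?divr_ge0//; apply: le_trans h; lra.
- exact: cvg_cst.
- rewrite -[X in _ --> X](mulr0 (k.+2`!%:R : R)); apply: cvgMl_tmp.
  exact: cvg_harmonic.
Unshelve. all: by end_near. Qed.

(** Integration by parts on [1/(n+2), n+2] stays away from the singularity at 0; the shift by 2
    makes the interval nondegenerate already for n = 0. *)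
Lemma eGamma_itv_rec a n : 0 < a ->
  (\int[leb]_(y in `[(n.+2%:R^-1)%R, n.+2%:R%R]) (y `^ (a + 1 - 1) * expR (- y))%R%:E =
   (n.+2%:R^-1 `^ a * expR (- n.+2%:R^-1) - n.+2%:R `^ a * expR (- n.+2%:R))%R%:E +
   a%:E * \int[leb]_(y in `[(n.+2%:R^-1)%R, n.+2%:R%R]) (y `^ (a - 1) * expR (- y))%R%:E)%E.
Proof.
move=> a0.
have n0 : 0 < n.+2%:R^-1 :> R by rewrite invr_gt0.
have lt1 : n.+2%:R^-1 < n.+2%:R :> R.
  by rewrite (@lt_trans _ _ 1)// ?invf_lt1// ltr1n.
have dpow b : {in `]n.+2%:R^-1, n.+2%:R[, forall x, derivable (fun y : R => y `^ b) x 1}.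
  move=> x; rewrite in_itv/= => /andP[x1 _]; apply: derivable_powR.
  by rewrite in_itv/= andbT (lt_trans _ x1).
have cpow b x : 0 < x -> {for x, continuous (fun y : R => y `^ b)}.
  move=> x0; apply: differentiable_continuous; apply/derivable1_diffP.
  by apply: derivable_powR; rewrite in_itv/= andbT.
have cexpN : continuous (fun y : R => expR (- y)).
  move=> x; apply: continuous_comp; last exact: continuous_expR.
  exact: continuousN.
have cpowW b : {within `[(n.+2%:R^-1 : R), n.+2%:R], continuous (fun y : R => y `^ b)}.
  apply: continuous_in_subspaceT => x; rewrite inE/= in_itv/= => /andP[x1 _].
  by apply: cpow; rewrite (lt_le_trans _ x1).
have := @integration_by_parts R (fun y => y `^ a) (fun y => - expR (- y))
  (fun y => a * y `^ (a - 1)) (fun y => expR (- y)) _ _ lt1.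
move=> /(_ _ _ _ _ _ _)/=.
rewrite addrK => ->.
- rewrite -ge0_integralZl_EFin ?ltW//.
  + under [X in (_ - X)%E]eq_integral => x _ do rewrite mulrN -mulrA EFinN EFinM.
    rewrite integral_ge0N ?oppeK; last first.
      by move=> x _; rewrite mule_ge0 ?Gamma_integrand_ge0// lee_fin ltW.
    by congr (_ + _)%E; congr EFin; ring.
  + by move=> x _; exact: Gamma_integrand_ge0.
  + exact: measurable_Gamma_integrand.
- by move=> x; apply: cvgM; [exact: cvg_cst|exact: cpowW].
- split; first exact: dpow.
  + apply: cvg_at_right_filter. exact: cpow.
  + by apply: cvg_at_left_filter; apply: cpow; rewrite (lt_trans _ lt1).
- move=> x; rewrite in_itv/= => /andP[x1 _].
  by apply: powR_derive1; rewrite in_itv/= andbT (lt_trans _ x1).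
- by apply: continuous_subspaceT; exact: cexpN.
- split.
  + move=> x _; exact: ex_derive.
  + apply: cvgN; apply: cvg_at_right_filter. exact: cexpN.
  + apply: cvgN; apply: cvg_at_left_filter. exact: cexpN.
- move=> x _. rewrite derive1E derive_val. ring.
Qed.

Lemma itv0y_bigcup :
  `]0%R, +oo[%classic = \bigcup_n [set` `[(n.+2%:R^-1)%R, n.+2%:R%R]] :> set R.
Proof.
apply/seteqP; split => x /=; rewrite in_itv/= ?andbT.
  move=> x0; have [n nx] : exists n : nat, x^-1 <= n.+2%:R /\ x <= n.+2%:R.
    exists (maxn (Num.truncn x^-1) (Num.truncn x)); split.
      apply: (@le_trans _ _ (Num.truncn x^-1).+1%:R); first by rewrite ltW// truncnS_gt.
      by rewrite ler_nat ltnS leqW// leq_maxl.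
    apply: (@le_trans _ _ (Num.truncn x).+1%:R); first by rewrite ltW// truncnS_gt.
    by rewrite ler_nat ltnS leqW// leq_maxr.
  by exists n => //=; rewrite in_itv/= nx.2 andbT -[leRHS]invrK lef_pV2// ?posrE ?invr_gt0//; case: nx.
by move=> [n _]/=; rewrite in_itv/= => /andP[h _]; rewrite (lt_le_trans _ h)// invr_gt0.
Qed.

Lemma eGamma_cvg a : ((\int[leb]_(y in `[(n.+2%:R^-1)%R, n.+2%:R%R]) (y `^ (a - 1) * expR (- y))%R%:E)%E
   @[n --> \oo] --> eGamma a)%E.
Proof.
rewrite /eGamma itv0y_bigcup.
apply: (@ge0_nondecreasing_set_cvg_integral _ (measurableTypeR R) R
   (fun n => [set` `[(n.+2%:R^-1)%R, n.+2%:R%R]] : set R)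
   (fun y : R => (y `^ (a - 1) * expR (- y))%R%:E) leb).
- move=> m n mn; apply/subsetPset => x /=; rewrite !in_itv/= => /andP[h1 h2].
  rewrite (le_trans _ h1) ?(le_trans h2)// ?ler_nat//.
  by rewrite lef_pV2 ?posrE// ler_nat.
- by move=> n; exact: measurable_itv.
- by move=> n; exact: measurable_Gamma_integrand.
- by move=> n x _; exact: Gamma_integrand_ge0.
Qed.

Lemma eGamma_rec a : 0 < a -> eGamma (a + 1) = (a%:E * eGamma a)%E.
Proof.
move=> a0; have := @eGamma_cvg (a + 1).
under eq_cvg do rewrite eGamma_itv_rec//.
move=> h; apply: (cvg_unique (@ereal_hausdorff R) h).
have cvgi : n.+2%:R^-1 @[n --> \oo] --> (0 : R).
  by have := @cvg_harmonic R; rewrite -cvg_shiftS.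
rewrite /= -[X in _ --> X]add0e; apply: cvgeD.
- by rewrite fin_num_adde_defr.
- apply: cvg_EFin; first exact: nearW.
  rewrite -[X in _ --> X](subr0 0); apply: cvgB; last exact: cvg_powR_expRN.
  rewrite -[X in _ --> X](mul0r 1); apply: cvgM.
  + have /cvg_at_rightP/(_ (fun n => n.+2%:R^-1)) := powR_cvg0 a0; apply.
    by split => // n; rewrite invr_gt0.
  + have c0 : {for 0, continuous (fun y : R => expR (- y))}.
      apply: continuous_comp; last exact: continuous_expR.
      exact: continuousN.
    rewrite [X in _ --> X](_ : 1 = expR (- 0)); last by rewrite oppr0 expR0.
    exact: (cvg_comp _ _ cvgi c0).
- by apply: cvgeZl => //; exact: eGamma_cvg.
Qed.

Lemma eGamma1 : eGamma 1 = 1%E.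
Proof.
rewrite /eGamma.
under eq_integral => x _ do rewrite subrr powRr0 mul1r.
rewrite integral_itv_obnd_cbnd; last first.
  apply/measurable_EFinP; apply: measurable_funTS; exact: measurableT_comp.
have cexpN : continuous (fun y : R => expR (- y)).
  move=> x; apply: continuous_comp; last exact: continuous_expR.
  exact: continuousN.
rewrite (@ge0_continuous_FTC2y R (fun x => expR (- x)) (fun x => - expR (- x)) 0 0).
- by rewrite oppr0 expR0 EFinN oppeK add0e.
- by move=> x _; exact: expR_ge0.
- exact: continuous_subspaceT.
- by rewrite -oppr0; apply: cvgN; exact: cvgr_expR.
- by move=> x _; exact: ex_derive.
- by apply: cvgN; apply: cvg_at_right_filter; exact: cexpN.
- by move=> x _; rewrite derive1E derive_val; ring.
Qed.
(** Young's inequality for t^x and 1 with the conjugate exponents 1/x and 1/(1 - x). *)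
Lemma powR_le_tangent x t : 0 <= t -> 0 < x < 1 -> t `^ x <= 1 + x * (t - 1).
Proof.
move=> t0 /andP[x0 x1]; have y0 : 0 < 1 - x by rewrite subr_gt0.
have := @conjugate_powR R (t `^ x) 1 x^-1 (1 - x)^-1 (powR_ge0 _ _) ler01.
rewrite !invr_gt0 !invrK mulr1 powR1 mul1r -powRrM divff ?gt_eqF// powRr1//.
move=> /(_ x0 y0); rewrite (_ : x + (1 - x) = 1); last by ring.
by move=> /(_ erefl) h; apply: le_trans h _; rewrite le_eqVlt; apply/orP; left; apply/eqP; ring.
Qed.

(** Wendel's inequality. The tangent bound for (y/z)^x is integrated against the Gamma density of
    parameter z, under which y/z has mean 1, so the linear term disappears. *)
Lemma eGammaD_le z x : 0 < z -> 0 < x < 1 ->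
  (eGamma (z + x) <= (z `^ x)%:E * eGamma z)%E.
Proof.
move=> z0 /andP[x0 x1].
have zx0 : 0 <= x * z `^ (x - 1) by rewrite mulr_ge0 ?powR_ge0 ?ltW.
have zx1 : 0 <= (1 - x) * z `^ x by rewrite mulr_ge0 ?powR_ge0// subr_ge0 ltW.
have G0 a : (0 <= eGamma a)%E.
  by apply: integral_ge0 => y _; exact: Gamma_integrand_ge0.
(* The affine function 1 + x (y/z - 1) is split with the nonnegative coefficients x/z and 1 - x, so
   that extended integrals can be added. *)
rewrite (_ : (_ * _ = (x * z `^ (x - 1))%:E * eGamma (z + 1) + ((1 - x) * z `^ x)%:E * eGamma z)%E); last first.
  rewrite eGamma_rec// muleA -EFinM -ge0_muleDl; [|by rewrite lee_fin mulr_ge0// ltW|by rewrite lee_fin].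
  rewrite -EFinD; congr (_%:E * _)%E.
  by rewrite -mulrA [_ * z]mulrC mulr_powRB1//; [ring|exact: ltW].
rewrite /eGamma -!ge0_integralZl_EFin//; try by move=> y _; exact: Gamma_integrand_ge0.
all: try exact: measurable_Gamma_integrand.
rewrite -ge0_integralD//.
- apply: ge0_le_integral => //.
  + by move=> y _; exact: Gamma_integrand_ge0.
  + exact: measurable_Gamma_integrand.
  + apply: emeasurable_funD; apply: measurable_funeM; exact: measurable_Gamma_integrand.
  + move=> y /=; rewrite in_itv/= andbT => y0.
    rewrite -!EFinM -EFinD lee_fin !mulrA -mulrDl ler_wpM2r ?expR_ge0//.
    have -> : z + x - 1 = z - 1 + x by ring.
    rewrite addrK (@powRD _ y (z - 1) x); last by rewrite (gt_eqF y0) implybT.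
    have h : (y / z) `^ x <= 1 + x * (y / z - 1).
      by apply: powR_le_tangent; rewrite ?x0// divr_ge0// ltW.
    have -> : y `^ x = (y / z) `^ x * z `^ x.
      by rewrite -powRM ?divr_ge0 ?ltW// divfK// gt_eqF.
    have -> : z `^ x = z * z `^ (x - 1) by rewrite mulr_powRB1// ltW.
    have -> : y `^ z = y * y `^ (z - 1) by rewrite mulr_powRB1// ltW.
    rewrite [leLHS](_ : _ = (y / z) `^ x * (y `^ (z - 1) * z * z `^ (x - 1))); last by ring.
    rewrite [leRHS](_ : _ = (1 + x * (y / z - 1)) * (y `^ (z - 1) * z * z `^ (x - 1))).
      by rewrite ler_wpM2r// !mulr_ge0 ?powR_ge0// ltW.
    by field; rewrite gt_eqF.
- by move=> y _; rewrite mule_ge0 ?lee_fin// mulr_ge0 ?powR_ge0 ?expR_ge0.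
- apply: measurable_funeM; exact: measurable_Gamma_integrand.
- by move=> y _; rewrite mule_ge0 ?lee_fin// mulr_ge0 ?powR_ge0 ?expR_ge0.
- apply: measurable_funeM; exact: measurable_Gamma_integrand.
Qed.

Lemma GammaE a : Gamma a = fine (eGamma a).
Proof. by []. Qed.

Lemma GammaS a : 0 < a -> Gamma (a + 1) = a * Gamma a.
Proof.
move=> a0; rewrite !GammaE eGamma_rec//.
(* If the integral is infinite, [fine] yields 0 on both sides. *)
case: (eGamma a) => [r| |] //=; first by rewrite mulr0 mulry gtr0_sg// mul1e.
by rewrite mulrNy gtr0_sg// mul1e mulr0.
Qed.

(** [eGammaD_le] at z = 1 gives a Gamma(a) = Gamma(1 + a) <= Gamma(1) = 1, so no estimate of the
    integral near 0 is made. *)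
Lemma eGamma_fin_num a : 0 < a < 1 -> eGamma a \is a fin_num.
Proof.
move=> /andP[a0 a1].
have G0 : (0 <= eGamma a)%E.
  by apply: integral_ge0 => y _; exact: Gamma_integrand_ge0.
rewrite ge0_fin_numE//; have := @eGammaD_le 1 a ltr01.
rewrite a0 a1 addrC eGamma1 powR1 mule1 eGamma_rec// => /(_ isT).
case: (eGamma a) G0 => [r _ _| |]//; first exact: ltry.
by rewrite mulry gtr0_sg// mul1e.
Qed.

Lemma eGammaDn_fin_num a n : 0 < a < 1 -> eGamma (a + n%:R) \is a fin_num.
Proof.
move=> a01; have /andP[a0 _] := a01; elim: n => [|n IH].
  by rewrite addr0 eGamma_fin_num.
by rewrite -natr1 addrA eGamma_rec ?fin_numM// ltr_wpDr.
Qed.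

Lemma eGammaSn n : eGamma n.+1%:R = n`!%:R%:E.
Proof.
elim: n => [|n IH]; first by rewrite eGamma1.
by rewrite -natr1 eGamma_rec// IH -EFinM factS natrM.
Qed.

Lemma GammaDn_le a n : 0 < a < 1 -> Gamma (a + n.+1%:R) <= n.+1%:R `^ a * n`!%:R.
Proof.
move=> a01; rewrite -lee_fin GammaE fineK ?eGammaDn_fin_num//.
by rewrite addrC (le_trans (eGammaD_le _ a01))// eGammaSn -EFinM.
Qed.

(** The companion of [GammaDn_le]: started at a + n + 1, the step 1 - a lands on the integer n +
    2. *)
Lemma le_GammaDn a n : 0 < a < 1 ->
  n.+1`!%:R <= (a + n.+1%:R) `^ (1 - a) * Gamma (a + n.+1%:R).
Proof.
move=> a01; have /andP[a0 a1] := a01.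
rewrite -lee_fin EFinM GammaE fineK ?eGammaDn_fin_num//.
rewrite -eGammaSn (_ : n.+2%:R = a + n.+1%:R + (1 - a)); last by rewrite -[n.+2%:R]natr1; ring.
by apply: eGammaD_le; [rewrite ltr_wpDr|rewrite subr_gt0 a1 gtrBl].
Qed.

Lemma Gamma_gt0 a : 0 < a < 1 -> 0 < Gamma a.
Proof.
move=> a01; have /andP[a0 a1] := a01.
have := le_GammaDn 0 a01; rewrite GammaS// => h.
have : 0 < (a + 1%:R) `^ (1 - a) * (a * Gamma a) by apply: lt_le_trans h.
by rewrite pmulr_rgt0 ?powR_gt0 ?ltr_wpDr// pmulr_rgt0.
Qed.
(* The coefficient of z^n in (1 - z)^(-x). *)
Definition rising_bin (x : R) (n : nat) : R := \prod_(k < n) ((k%:R + x) / k.+1%:R).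

Lemma rising_binS x n : rising_bin x n.+1 = rising_bin x n * ((n%:R + x) / n.+1%:R).
Proof. by rewrite /rising_bin big_ord_recr. Qed.

Lemma rising_bin_gt0 x n : 0 < x -> 0 < rising_bin x n.
Proof. by move=> x0; apply: prodr_gt0 => k _; rewrite divr_gt0// ltr_wpDl. Qed.

Lemma GammaDn a n : 0 < a -> Gamma (a + n%:R) = Gamma a * rising_bin a n * n`!%:R.
Proof.
move=> a0; elim: n => [|n IH]; first by rewrite addr0 /rising_bin big_ord0 !mulr1.
rewrite -natr1 addrA GammaS ?ltr_wpDr// IH rising_binS factS natrM -natr1.
by field; rewrite natr1 pnatr_eq0.
Qed.

(** Gauss's product formula: [GammaDn] turns the product into a quotient of Gamma values, squeezed
    by [le_GammaDn] and [GammaDn_le]. *)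
Lemma rising_bin_Gamma a : 0 < a < 1 ->
  (fun n => n%:R `^ (1 - a) * rising_bin a n) @ \oo --> (Gamma a)^-1.
Proof.
move=> a01; have /andP[a0 a1] := a01.
have Ga := Gamma_gt0 a01; rewrite -cvg_shiftS.
have E n : rising_bin a n.+1 = Gamma (a + n.+1%:R) / (Gamma a * n.+1`!%:R).
  rewrite GammaDn//; field; rewrite gt_eqF//= gt_eqF// ltr0n fact_gt0//.
have f0 n : 0 < n`!%:R :> R by rewrite ltr0n fact_gt0.
apply: (@squeeze_cvgr _ _ _ _ (fun n => (1 - n.+2%:R^-1) / Gamma a) (cst (Gamma a)^-1)).
- near=> n; apply/andP; split.
  + rewrite /= E; have := le_GammaDn n a01.
    set G := Gamma (a + n.+1%:R); set z := a + n.+1%:R => h.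
    have z0 : 0 < z by rewrite ltr_wpDr.
    have zp : 0 < z `^ (1 - a) by rewrite powR_gt0.
    have zh : n.+1`!%:R / z `^ (1 - a) <= G by rewrite ler_pdivrMr// mulrC.
    apply: (@le_trans _ _ (n.+1%:R `^ (1 - a) * (n.+1`!%:R / z `^ (1 - a) / (Gamma a * n.+1`!%:R)))); last first.
      by rewrite ler_wpM2l ?powR_ge0// ler_wpM2r// ltW// invr_gt0 mulr_gt0.
    rewrite [leRHS](_ : _ = n.+1%:R `^ (1 - a) / z `^ (1 - a) / Gamma a); last first.
      by field; rewrite !gt_eqF.
    rewrite ler_pM2r ?invr_gt0//.
    have -> : n.+1%:R `^ (1 - a) / z `^ (1 - a) = (n.+1%:R / z) `^ (1 - a).
      apply: (mulIf (lt0r_neq0 zp)).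
      by rewrite divfK ?gt_eqF// -powRM ?divr_ge0 ?(ltW z0)// divfK// gt_eqF.
    have t0 : 0 < n.+1%:R / z <= 1.
      by rewrite divr_gt0//= ler_pdivrMr// mul1r /z lerDr ltW.
    (* A number in (0, 1] does not decrease under the power 1 - a <= 1, and z <= n + 2; this is the
       origin of the factor 1 - 1/(n+2). *)
    apply: le_trans (ger1_powR t0 _); last by rewrite gerBl ltW.
    rewrite ler_pdivlMr// /z -[n.+2%:R]natr1 -ler_pdivlMl; last first.
      by rewrite subr_gt0 natr1 invf_lt1 ?ltr1n.
    have -> : (1 - (n.+1%:R + 1)^-1)^-1 * n.+1%:R = n.+1%:R + 1 :> R.
      have : 0 < n.+1%:R :> R by [].
      move: (n.+1%:R : R) => N N0; field; rewrite addrK (gt_eqF N0)/= gt_eqF//.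
      by rewrite addr_gt0.
    by rewrite addrC lerD2l ltW.
  + rewrite /= E; have h := GammaDn_le n a01.
    apply: (@le_trans _ _ (n.+1%:R `^ (1 - a) * (n.+1%:R `^ a * n`!%:R / (Gamma a * n.+1`!%:R)))).
      by rewrite ler_wpM2l ?powR_ge0// ler_wpM2r// ltW// invr_gt0 mulr_gt0.
    rewrite [leLHS](_ : _ = (n.+1%:R `^ (1 - a) * n.+1%:R `^ a) * n`!%:R / n.+1`!%:R / Gamma a); last first.
      by field; rewrite !gt_eqF.
    rewrite -powRD ?pnatr_eq0 ?implybT// subrK powRr1// -natrM -factS divff ?mul1r//.
- rewrite -[X in _ --> X]mul1r -[X in X / Gamma a](subr0 1).
  apply: cvgMr_tmp; apply: cvgB; first exact: cvg_cst.
  by have := @cvg_harmonic R; rewrite -cvg_shiftS.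
- exact: cvg_cst.
Unshelve. all: by end_near. Qed.

End Gamma_function.
(** * Slowly varying sequences and the renewal theorem *)

Section regular_variation.
Context {R : realType}.
Implicit Types (a M p r u v : nat -> R) (delta eps eta kappa theta : R).

(* Slow variation in uniform form, so that no uniform convergence theorem is
   needed. *)
Definition slowly_varying M := forall eps eta, 0 < eps -> 0 < eta ->
  exists N, forall i j, (N <= i)%N -> (N <= j)%N ->
    eps * i%:R <= j%:R -> eps * j%:R <= i%:R -> `|M i - M j| <= eta * M j.

(** Bernoulli's inequality for a product of n - k factors 1 - eta / j, each at least 1 - eta / k. *)
Lemma ratio_lower_bound M eta k n : 0 <= eta <= 1 -> (0 < k)%N -> (k <= n)%N ->
  (forall j, 0 <= M j) ->
  (forall j, (k <= j)%N -> M j * (1 - eta / j%:R) <= M j.+1) ->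
  M k * (1 - (n%:R - k%:R) * (eta / k%:R)) <= M n.
Proof.
move=> /andP[e0 e1] k0 kn M0 H.
have kR : 0 < k%:R :> R by rewrite ltr0n.
have ek0 : 0 <= eta / k%:R by rewrite divr_ge0// ltW.
have ek1 : eta / k%:R <= 1 by rewrite ler_pdivrMr// mul1r (le_trans e1)// ler1n.
elim: n kn => [|n IH]; first by rewrite leqn0 => /eqP kE; rewrite kE in k0.
rewrite leq_eqVlt => /predU1P[->|]; first by rewrite subrr mul0r subr0 mulr1.
rewrite ltnS => kn; apply: le_trans (H _ kn).
have nk : (k%:R : R) <= n%:R by rewrite ler_nat.
have ekn : eta / n%:R <= eta / k%:R.
  by rewrite ler_wpM2l// lef_pV2 ?posrE// (lt_le_trans kR).
apply: (@le_trans _ _ (M n * (1 - eta / k%:R))); last first.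
  by rewrite ler_wpM2l// lerD2l lerN2.
apply: (@le_trans _ _ (M k * (1 - (n%:R - k%:R) * (eta / k%:R)) * (1 - eta / k%:R))); last first.
  by rewrite ler_wpM2r ?IH// subr_ge0.
rewrite -mulrA ler_wpM2l// -[n.+1%:R]natr1.
set e := eta / k%:R in ek0 ek1 *; set d := n%:R - k%:R.
have d0 : 0 <= d by rewrite subr_ge0.
have -> : n%:R + 1 - k%:R = d + 1 by rewrite /d; ring.
have : 0 <= d * e * e by rewrite !mulr_ge0.
by nra.
Qed.

(** From k to n <= k / eps there are fewer than k / eps steps, each with a relative change of at
    most e / k; the total is at most e / eps. *)
Lemma slowly_varying_ratio M : (forall n, 0 < M n) ->
  (fun n => n%:R * (1 - M n.+1 / M n)) @ \oo --> (0 : R) -> slowly_varying M.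
Proof.
move=> M0 HM eps eta eps0 eta0.
(* A relative error x <= 1/4 becomes at most 4 x / 3 <= eta when measured against the other
   value. *)
pose x := Num.min (1 / 4) (eta / 4).
have x0 : 0 < x by rewrite lt_min !divr_gt0.
have x1 : x <= 1 / 4 by rewrite ge_min lexx.
have x2 : x <= eta / 4 by rewrite ge_min lexx orbT.
pose e := Num.min 1 (eps * x).
have e0 : 0 < e by rewrite lt_min ltr01 mulr_gt0.
have e01 : 0 <= e <= 1 by rewrite ltW// ge_min lexx.
have ex : e <= eps * x by rewrite ge_min lexx orbT.
have [N0 _ HN] := (cvgr0Pnorm_lt _).1 HM e e0.
have M0' j : 0 <= M j by rewrite ltW.
have iM0 j : 0 <= (M j)^-1 by rewrite invr_ge0.
have H1 j : (N0.+1 <= j)%N -> M j * (1 - e / j%:R) <= M j.+1 <= M j * (1 + e / j%:R).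
  move=> Nj; have j0 : 0 < j%:R :> R by rewrite ltr0n (leq_trans _ Nj).
  have /= := HN j (ltnW Nj); rewrite ltr_norml => /andP[h1 h2].
  have E : M j.+1 = M j * (1 - (j%:R * (1 - M j.+1 / M j)) / j%:R).
    by field; rewrite !gt_eqF.
  have y1 : (j%:R * (1 - M j.+1 / M j)) / j%:R <= e / j%:R.
    by rewrite ler_pM2r ?invr_gt0// ltW.
  have y2 : - (e / j%:R) <= (j%:R * (1 - M j.+1 / M j)) / j%:R.
    by rewrite -mulNr ler_pM2r ?invr_gt0// ltW.
  move: E y1 y2; set y := _ / j%:R => -> y1 y2.
  by rewrite !ler_pM2l//; apply/andP; split; lra.
(* The same lower recursion for 1 / M lets [ratio_lower_bound] bound M from above as well. *)
have H2 j : (N0.+1 <= j)%N -> (M j)^-1 * (1 - e / j%:R) <= (M j.+1)^-1.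
  move=> Nj; have j0 : 0 < j%:R :> R by rewrite ltr0n (leq_trans _ Nj).
  have /andP[_ h] := H1 j Nj.
  rewrite -[leRHS]mul1r ler_pdivlMr// -mulrA ler_pdivrMl// mulr1.
  have ej : e / j%:R <= 1.
    have /andP[_ e1] := e01.
    by rewrite ler_pdivrMr// mul1r (le_trans e1)// ler1n (leq_trans _ Nj).
  apply: (@le_trans _ _ ((1 - e / j%:R) * (M j * (1 + e / j%:R)))).
    by rewrite ler_wpM2l// subr_ge0.
  have : 0 <= M j * ((e / j%:R) * (e / j%:R)) by rewrite !mulr_ge0 ?divr_ge0// ltW.
  by nra.
have key k n : (N0.+1 <= k)%N -> (k <= n)%N -> eps * n%:R <= k%:R ->
    M k * (1 - x) <= M n /\ M n * (1 - x) <= M k.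
  move=> Nk kn en; have k0 : (0 < k)%N by rewrite (leq_trans _ Nk).
  have kR : 0 < k%:R :> R by rewrite ltr0n.
  have y : (n%:R - k%:R) * (e / k%:R) <= x.
    rewrite mulrA ler_pdivrMr//.
    apply: (@le_trans _ _ (n%:R * (eps * x))).
      apply: ler_pM => //; rewrite ?subr_ge0 ?ler_nat ?(ltW e0)//.
      by rewrite gerBl.
    by rewrite mulrA [x * _]mulrC [n%:R * _]mulrC ler_wpM2r// ltW.
  have h1 : M k * (1 - (n%:R - k%:R) * (e / k%:R)) <= M n.
    apply: ratio_lower_bound => // j kj.
    by have /andP[] := H1 j (leq_trans Nk kj).
  have h2 : (M k)^-1 * (1 - (n%:R - k%:R) * (e / k%:R)) <= (M n)^-1.
    apply: (@ratio_lower_bound (fun j => (M j)^-1)) => // j kj.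
    exact: H2 (leq_trans Nk kj).
  split.
    by apply: le_trans h1; rewrite ler_wpM2l// lerD2l lerN2.
  rewrite -[leRHS]mul1r -ler_pdivrMr//.
  have : (M k)^-1 * (1 - x) <= (M n)^-1.
    by apply: le_trans h2; rewrite ler_wpM2l// lerD2l lerN2.
  rewrite -[X in _ <= X -> _]mul1r ler_pdivlMr// => h.
  by apply: le_trans h; rewrite le_eqVlt; apply/orP; left; apply/eqP; ring.
exists N0.+1 => i j Ni Nj eij eji.
have [h1 h2] : M i * (1 - x) <= M j /\ M j * (1 - x) <= M i.
  have [ij|/ltnW ji] := leqP i j; first exact: key.
  by have [] := key j i Nj ji eij.
rewrite ler_norml; have Mj := M0 j; have Mi := M0 i; apply/andP; split; nra.
Qed.

(** Karamata's bound for an index -delta > -1. At each step the right side grows by about C (1 - d')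
    a n, where delta < d' < 1, and this exceeds the new term once C (1 - d') >= 2. *)
Lemma partial_sum_le a delta : (forall n, 0 < a n) -> 0 <= delta < 1 ->
  (fun n => n%:R * (1 - a n.+1 / a n)) @ \oo --> delta ->
  exists (C : R) N, 0 < C /\ forall n, (N <= n)%N ->
    \sum_(k < n.+1) a k <= C * n.+1%:R * a n.
Proof.
move=> a0 /andP[d0 d1] Ha.
pose d' := (1 + delta) / 2; have d'0 : 0 <= d' by rewrite /d'; lra.
have d'1 : d' < 1 by rewrite /d'; lra.
have dd' : delta < d' by rewrite /d'; lra.
have [N0 _ HN] := cvgr_lt delta Ha d' dd'.
have c0 : 0 < 1 - d' by rewrite subr_gt0.
(* Beyond [N] one has n (1 - d') >= 4, which absorbs the error of order 1/n in the growth. *)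
pose N := maxn N0.+1 (Num.truncn (4 / (1 - d'))).+1.
have S0 n : 0 < \sum_(k < n.+1) a k.
  by rewrite big_ord_recr /= ltr_wpDl// sumr_ge0// => k _; exact: ltW.
(* The first summand drives the induction step, the second makes the claim true at [N]. *)
pose C := 2 / (1 - d') + (\sum_(k < N.+1) a k) / (N.+1%:R * a N).
have C1 : 2 / (1 - d') <= C.
  by rewrite lerDl divr_ge0// ?(ltW (S0 _))// mulr_ge0// ltW.
have C0 : 0 < C by apply: lt_le_trans C1; rewrite divr_gt0.
exists C, N; split => //; elim=> [|n IH].
  by rewrite leqn0 /N gtn_eqF// (leq_trans _ (leq_maxl _ _)).
rewrite leq_eqVlt => /predU1P[<-|].
  rewrite -mulrA -ler_pdivrMr ?mulr_gt0// /C lerDr divr_ge0// ltW//.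
rewrite ltnS => Nn; rewrite big_ord_recr/=.
have nN0 : (N0 <= n)%N by rewrite (leq_trans _ Nn)// (leq_trans (leqnSn _))// leq_maxl.
have n0 : 0 < n%:R :> R by rewrite ltr0n (leq_trans _ Nn)// (leq_trans _ (leq_maxl _ _)).
have n4 : 4 <= n%:R * (1 - d').
  rewrite -ler_pdivrMr//; apply: (@le_trans _ _ (Num.truncn (4 / (1 - d'))).+1%:R).
    by rewrite ltW// truncnS_gt.
  by rewrite ler_nat (leq_trans _ Nn)// leq_maxr.
have h : a n * (1 - d' / n%:R) <= a n.+1.
  have /= hn := HN n nN0.
  by rewrite -ler_pdivlMl// [_^-1 * _]mulrC lerBlDl -lerBlDr ler_pdivlMr// [_ * n%:R]mulrC ltW.
apply: (@le_trans _ _ (C * n.+1%:R * a n + a n.+1)); first by rewrite lerD2r IH.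
have C2 : 2 <= C * (1 - d') by rewrite -ler_pdivrMr.
suff : C * n.+1%:R * a n <= (C * n.+2%:R - 1) * a n.+1 by lra.
have C3 : 0 <= C * n.+2%:R - 1.
  rewrite -[n.+2%:R]natr1 -natr1; nra.
apply: (@le_trans _ _ ((C * n.+2%:R - 1) * (a n * (1 - d' / n%:R)))); last first.
  by rewrite ler_wpM2l.
rewrite [leRHS](_ : _ = (C * n.+2%:R - 1) * (n%:R - d') / n%:R * a n); last first.
  by field; rewrite gt_eqF.
rewrite ler_pM2r// ler_pdivlMr// -[n.+2%:R]natr1 -natr1.
move: (n%:R : R) n0 n4 => x n0 n4.
have : 0 <= C * (x * (1 - d') - 4) by rewrite mulr_ge0 ?subr_ge0// ltW.
have : 0 <= (C * (1 - d') - 2) * x by rewrite mulr_ge0 ?subr_ge0// ltW.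
have : 0 <= C * (1 - d') by rewrite mulr_ge0// ltW.
nra.
Qed.

(** For m of order eps n, m p m is of order eps^(1 - delta) n p n, which is small because delta <
    1. *)
Lemma powR_asymp_block p delta (kappa : R) : 0 <= delta < 1 -> 0 < kappa ->
  (forall n, 0 < p n) ->
  (fun n => n%:R `^ delta * p n) @ \oo --> kappa -> forall theta, 0 < theta ->
  exists eps, 0 < eps <= 1 / 4 /\ exists N, forall n m, (N <= n)%N ->
    eps * n%:R <= m%:R <= 2 * eps * n%:R -> m.+1%:R * p m <= theta * n%:R * p n.
Proof.
move=> /andP[d0 d1] k0 p0 Hp theta t0.
have d1' : 0 < 1 - delta by rewrite subr_gt0.
(* The constant 16 is 4 times 4: m + 1 <= 4 eps n and p m <= 4 eps^(-delta) p n. *)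
pose eps := Num.min (1 / 4) ((theta / 16) `^ (1 - delta)^-1).
have e0 : 0 < eps by rewrite lt_min divr_gt0//= powR_gt0// divr_gt0.
have et : eps `^ (1 - delta) <= theta / 16.
  apply: (@le_trans _ _ (((theta / 16) `^ (1 - delta)^-1) `^ (1 - delta))).
    apply: ge0_ler_powR; rewrite ?nnegrE ?(ltW e0) ?powR_ge0 ?(ltW d1')//.
    by rewrite ge_min lexx orbT.
  by rewrite -powRrM mulVf ?gt_eqF// powRr1// divr_ge0// ltW.
exists eps; split; first by rewrite e0/= ge_min lexx.
have k2 : kappa < 2 * kappa by lra.
have [N1 _ HN1] := cvgr_lt kappa Hp _ k2.
have k1 : kappa / 2 < kappa by lra.
have [N2 _ HN2] := cvgr_gt kappa Hp _ k1.
pose K := maxn 1 (maxn N1 N2).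
exists (maxn K (Num.truncn (K%:R / eps)).+1) => n m Nn /andP[em me].
have nK : K%:R <= eps * n%:R.
  rewrite -ler_pdivrMl// mulrC; apply: (@le_trans _ _ (Num.truncn (K%:R / eps)).+1%:R).
    by rewrite ltW// truncnS_gt.
  by rewrite ler_nat (leq_trans _ Nn)// leq_maxr.
have mK : (K <= m)%N by rewrite -(ler_nat R) (le_trans nK).
have Kn : (K <= n)%N by rewrite (leq_trans _ Nn)// leq_maxl.
have m0 : 0 < m%:R :> R by rewrite ltr0n (leq_trans _ mK)// leq_maxl.
have n0 : 0 < n%:R :> R by rewrite ltr0n (leq_trans _ Kn)// leq_maxl.
have /= h1 := HN1 m (leq_trans (leq_trans (leq_maxl _ _) (leq_maxr _ _)) mK).
have /= h2 := HN2 n (leq_trans (leq_trans (leq_maxr _ _) (leq_maxr _ _)) Kn).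
have md0 : 0 < m%:R `^ delta :> R by rewrite powR_gt0.
have ed0 : 0 < eps `^ delta :> R by rewrite powR_gt0.
have nm : eps `^ delta * n%:R `^ delta <= m%:R `^ delta.
  rewrite -powRM ?(ltW e0)//; apply: ge0_ler_powR; rewrite ?nnegrE//.
  by rewrite mulr_ge0// ltW.
have pm : eps `^ delta * p m <= 4 * p n.
  rewrite -(ler_pM2l md0).
  have a1 : eps `^ delta * (m%:R `^ delta * p m) <= eps `^ delta * (2 * kappa).
    by rewrite ler_wpM2l ?ltW.
  have a2 : eps `^ delta * (2 * kappa) <= eps `^ delta * (4 * (n%:R `^ delta * p n)).
    rewrite ler_wpM2l ?(ltW ed0)//; lra.
  have a3 : (eps `^ delta * n%:R `^ delta) * (4 * p n) <= m%:R `^ delta * (4 * p n).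
    have p4 : 0 <= 4 * p n by rewrite mulr_ge0// ltW.
    exact: ler_wpM2r p4 _ _ nm.
  nra.
have ee : eps = eps `^ delta * eps `^ (1 - delta).
  rewrite -powRD; last by rewrite (gt_eqF e0) implybT.
  by rewrite [delta + _]addrC subrK powRr1// ltW.
have m1 : 1 <= m%:R :> R by rewrite ler1n -(ltr0n R).
have b1 : m.+1%:R <= 4 * eps * n%:R by rewrite -natr1; lra.
apply: (@le_trans _ _ (4 * eps * n%:R * p m)).
  by rewrite ler_wpM2r// ltW.
have -> : 4 * eps * n%:R * p m = 4 * n%:R * eps `^ (1 - delta) * (eps `^ delta * p m).
  by rewrite {1}ee; ring.
apply: (@le_trans _ _ (4 * n%:R * eps `^ (1 - delta) * (4 * p n))).
  by rewrite ler_wpM2l// !mulr_ge0// ?powR_ge0 ?ltW.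
have c0 : 0 <= 16 * n%:R * p n by rewrite !mulr_ge0// ltW.
have := ler_wpM2l c0 et.
by congr (_ <= _); [ring|field].
Qed.
(* M k is close to M n except for k < eps n. There r (n - k) <= r (n - m) with
   m ~ eps n, while the terms k >= m of the denominator are at least
   r (n - m) p n each, so the last hypothesis makes the exceptional part
   negligible. *)
Lemma slowly_varying_conv M p r : (forall n, 0 < M n) -> slowly_varying M ->
  (forall n, 0 < p n) -> (forall m n, (m <= n)%N -> p n <= p m) ->
  (forall n, 0 <= r n) -> (forall m n, (m <= n)%N -> r n <= r m) -> 0 < r 0 ->
  (exists (C : R) N, 0 < C /\ forall n, (N <= n)%N ->
    \sum_(k < n.+1) p k <= C * n.+1%:R * p n) ->
  (exists (C : R) N, 0 < C /\ forall n, (N <= n)%N ->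
    \sum_(k < n.+1) M k * p k <= C * n.+1%:R * (M n * p n)) ->
  (forall theta, 0 < theta ->
    exists eps, 0 < eps <= 1 / 4 /\ exists N, forall n m, (N <= n)%N ->
      eps * n%:R <= m%:R <= 2 * eps * n%:R -> m.+1%:R * p m <= theta * n%:R * p n) ->
  (fun n => (\sum_(k < n.+1) M k * p k * r (n - k)%N) /
            (M n * \sum_(k < n.+1) p k * r (n - k)%N)) @ \oo --> (1 : R).
Proof.
move=> M0 HM p0 pdec r0 rdec r00 [C1 [N1 [C10 H1]]] [C2 [N2 [C20 H2]]] H3.
apply/cvgrPdistC_le => eta eta0.
(* The weight 2 C2 + C1 arises from M m <= 2 M n. With (2 C2 + C1) theta = eta / 4 and the n/2 terms
   counted in [Tlow], the range k < m costs eta / 2. *)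
pose theta := eta / (4 * (2 * C2 + C1)).
have CC0 : 0 < 2 * C2 + C1 by rewrite addr_gt0// mulr_gt0.
have t0 : 0 < theta by rewrite divr_gt0// mulr_gt0.
have [eps [/andP[e0 e4] [N3 H3']]] := H3 _ t0.
pose eta' := Num.min 1 (eta / 2).
have eta'0 : 0 < eta' by rewrite lt_min ltr01 divr_gt0.
have [N4 H4] := HM _ _ e0 eta'0.
pose K := maxn (maxn 1 N1) (maxn (maxn N2 N3) N4).
exists (maxn K (Num.truncn (K%:R / eps)).+1) => // n /= Nn.
have nK : K%:R <= eps * n%:R.
  rewrite -ler_pdivrMl// mulrC; apply: (@le_trans _ _ (Num.truncn (K%:R / eps)).+1%:R).
    by rewrite ltW// truncnS_gt.
  by rewrite ler_nat (leq_trans _ Nn)// leq_maxr.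
pose m := (Num.truncn (eps * n%:R)).+1.
have em : eps * n%:R <= m%:R by rewrite ltW// truncnS_gt.
have mK : (K <= m)%N by rewrite -(ler_nat R) (le_trans nK).
have Kn : (K <= n)%N by rewrite (leq_trans _ Nn)// leq_maxl.
have K1 : (1 <= K)%N by rewrite (leq_trans (leq_maxl 1 N1))// leq_maxl.
have KN1 : (N1 <= K)%N by rewrite /K !leq_max leqnn ?orbT.
have KN2 : (N2 <= K)%N by rewrite /K !leq_max leqnn ?orbT.
have KN3 : (N3 <= K)%N by rewrite /K !leq_max leqnn ?orbT.
have KN4 : (N4 <= K)%N by rewrite /K !leq_max leqnn ?orbT.
have me : m%:R <= 2 * eps * n%:R.
  rewrite /m -natr1.
  have h : (Num.truncn (eps * n%:R))%:R <= eps * n%:R.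
    by rewrite truncn_le// mulr_ge0// ltW.
  have : 1 <= K%:R :> R by rewrite ler1n.
  lra.
clearbody m.
have ek k : eps * k%:R <= k%:R by rewrite ler_piMl//; lra.
have n0 : 0 < n%:R :> R by rewrite ltr0n (leq_trans K1).
have mn2 : m%:R <= n%:R / 2 :> R.
  by apply: le_trans me _; rewrite [leRHS]mulrC ler_pM2r//; lra.
have mn : (m <= n)%N by rewrite -(ler_nat R); lra.
have Mn := M0 n.
pose T := \sum_(k < n.+1) p k * r (n - k)%N.
have T0 : 0 < T.
  rewrite /T big_ord_recr/= subnn ltr_wpDl ?mulr_gt0// sumr_ge0// => k _.
  by rewrite mulr_ge0// ltW.
have TE : T = \sum_(0 <= k < m) p k * r (n - k)%N +
              \sum_(m <= k < n.+1) p k * r (n - k)%N.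
  by rewrite /T -(big_mkord xpredT (fun k => p k * r (n - k)%N))
    (big_cat_nat (n := m))// leqW.
have pr0 k : 0 <= p k * r (n - k)%N by rewrite mulr_ge0// ltW.
have Tlow : n%:R / 2 * (p n * r (n - m)%N) <= T.
  rewrite TE; apply: (@le_trans _ _ (\sum_(m <= k < n.+1) p k * r (n - k)%N)); last first.
    by rewrite lerDr sumr_ge0.
  apply: (@le_trans _ _ (\sum_(m <= k < n.+1) p n * r (n - m)%N)); last first.
    rewrite !big_nat; apply: ler_sum => k /andP[mk kn].
    by apply: ler_pM => //; rewrite ?(ltW (p0 _)) ?pdec ?rdec// leq_sub2l.
  rewrite big_const_nat iter_addr_0 -[leRHS]mulr_natl ler_wpM2r ?mulr_ge0// ?(ltW (p0 _))//.
  by rewrite natrB ?leqW// -[n.+1%:R]natr1; lra.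
suff key : `|\sum_(k < n.+1) M k * p k * r (n - k)%N - M n * T| <= eta * (M n * T).
  rewrite -/T -[X in _ / _ - X](@divff _ (M n * T)) ?gt_eqF ?mulr_gt0// -mulrBl.
  by rewrite normrM [X in _ * X]gtr0_norm ?invr_gt0 ?mulr_gt0// ler_pdivrMr// mulr_gt0.
rewrite [X in _ - X](mulr_sumr) -sumrB.
apply: le_trans (ler_norm_sum _ _ _) _.
rewrite -(big_mkord xpredT (fun k => `|M k * p k * r (n - k)%N - M n * (p k * r (n - k)%N)|)).
rewrite (big_cat_nat (n := m))// ?leqW//=.
have E k : `|M k * p k * r (n - k)%N - M n * (p k * r (n - k)%N)| =
    `|M k - M n| * (p k * r (n - k)%N).
  by rewrite -mulrA -mulrBl normrM (ger0_norm (pr0 k)).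
have eM : 0 <= eta / 2 * M n by apply: mulr_ge0; [apply: divr_ge0|]; rewrite // ltW.
have B1 : \sum_(m <= k < n.+1) `|M k * p k * r (n - k)%N - M n * (p k * r (n - k)%N)|
    <= eta / 2 * (M n * T).
  apply: (@le_trans _ _ (\sum_(m <= k < n.+1) (eta / 2 * M n) * (p k * r (n - k)%N))).
    rewrite !big_nat; apply: ler_sum => k /andP[mk kn].
    rewrite E ler_wpM2r//; apply: (@le_trans _ _ (eta' * M n)).
      apply: H4.
      - by rewrite (leq_trans KN4)// (leq_trans mK).
      - by rewrite (leq_trans KN4).
      - by rewrite (@le_trans _ _ k%:R)// ler_nat.
      - by rewrite (le_trans em)// ler_nat.
    by rewrite ler_pM2r// ge_min lexx orbT.
  rewrite -mulr_sumr mulrA; apply: ler_wpM2l eM _ _ _.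
  by rewrite TE lerDr sumr_ge0.
have B2 : \sum_(0 <= k < m) `|M k * p k * r (n - k)%N - M n * (p k * r (n - k)%N)|
    <= eta / 2 * (M n * T).
  have Mm : M m <= 2 * M n.
    have : `|M m - M n| <= eta' * M n.
      apply: H4; rewrite ?(leq_trans KN4)//.
      by rewrite (@le_trans _ _ m%:R)// ler_nat.
    rewrite ler_norml => /andP[_ h].
    have : eta' * M n <= 1 * M n by rewrite ler_pM2r// ge_min lexx.
    lra.
  apply: (@le_trans _ _ (\sum_(0 <= k < m.+1) ((M k * p k + M n * p k) * r (n - m)%N))).
    rewrite big_nat_recr//=; apply: ler_wpDr.
      by rewrite mulr_ge0// addr_ge0// mulr_ge0 ?(ltW (p0 _)) ?(ltW (M0 _)).
    rewrite !big_nat; apply: ler_sum => k /andP[_ km].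
    rewrite E -mulrDl -mulrA; apply: ler_pM => //.
      by apply: le_trans (ler_normB _ _) _; rewrite !gtr0_norm.
    by rewrite ler_wpM2l ?(ltW (p0 _))// rdec// leq_sub2l// ltnW.
  rewrite -mulr_suml big_split/= -mulr_sumr !big_mkord.
  have h1 := H1 m (leq_trans KN1 mK).
  have h2 := H2 m (leq_trans KN2 mK).
  have h3 : m.+1%:R * p m <= theta * n%:R * p n.
    by apply: H3'; rewrite ?em// (leq_trans KN3).
  have q0 : 0 <= m.+1%:R * p m by rewrite mulr_ge0// ltW.
  have h4 : C2 * m.+1%:R * (M m * p m) <= C2 * 2 * M n * (m.+1%:R * p m).
    rewrite [leLHS](_ : _ = (C2 * (m.+1%:R * p m)) * M m); last by ring.
    rewrite [leRHS](_ : _ = (C2 * (m.+1%:R * p m)) * (2 * M n)); last by ring.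
    by rewrite ler_wpM2l// mulr_ge0// ltW.
  have h5 : M n * (\sum_(k < m.+1) p k) <= M n * (C1 * m.+1%:R * p m).
    by rewrite ler_pM2l.
  have h6 : (2 * C2 + C1) * M n * (m.+1%:R * p m) <= (2 * C2 + C1) * M n * (theta * n%:R * p n).
    by rewrite ler_wpM2l// mulr_ge0// ltW.
  have h7 : (2 * C2 + C1) * M n * (theta * n%:R * p n) = eta / 2 * M n * (n%:R / 2 * p n).
    by rewrite /theta; field; rewrite gt_eqF.
  have h8 : \sum_(k < m.+1) M k * p k + M n * (\sum_(k < m.+1) p k) <=
      eta / 2 * M n * (n%:R / 2 * p n) by nra.
  apply: (@le_trans _ _ (eta / 2 * M n * (n%:R / 2 * p n) * r (n - m)%N)).
    by rewrite ler_wpM2r.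
  rewrite [leLHS](_ : _ = eta / 2 * M n * (n%:R / 2 * (p n * r (n - m)%N))); last by ring.
  by rewrite [leRHS]mulrA; apply: ler_wpM2l eM _ _ Tlow.
by move: B1 B2; set x := \sum_(0 <= k < m) _; set y := \sum_(m <= k < n.+1) _; lra.
Qed.
Lemma cvg_div_natD delta : 0 <= delta ->
  (fun n => (n%:R + delta)^-1) @ \oo --> (0 : R).
Proof.
move=> d0; rewrite -cvg_shiftS.
apply: (@squeeze_cvgr _ _ _ _ (cst 0) (fun n => n.+1%:R^-1)); last first.
- exact: cvg_harmonic.
- exact: cvg_cst.
near=> n => /=; rewrite invr_ge0 addr_ge0//= lef_pV2 ?posrE ?ltr_wpDr//.
by rewrite lerDl.
Unshelve. all: by end_near. Qed.

Lemma cvg_nat_divD delta : 0 <= delta ->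
  (fun n => n%:R / (n%:R + delta)) @ \oo --> (1 : R).
Proof.
move=> d0; have h := cvg_div_natD d0.
have : (fun n => 1 - delta * (n%:R + delta)^-1) @ \oo --> (1 - delta * 0 : R).
  by apply: cvgB; [exact: cvg_cst|exact: cvgMl_tmp].
rewrite mulr0 subr0; apply: cvg_trans; apply: near_eq_cvg; near=> n.
have n0 : 0 < n%:R :> R by rewrite ltr0n; near: n; exact: nbhs_infty_gt.
by field; rewrite gt_eqF// ltr_wpDr.
Unshelve. all: by end_near. Qed.

Lemma cvg_truncn_div (h : R) : 0 < h ->
  (fun n => (Num.truncn (h * n%:R))%:R / n%:R) @ \oo --> h.
Proof.
move=> h0.
apply: (@squeeze_cvgr _ _ _ _ (fun n => h - n%:R^-1) (cst h)); last exact: cvg_cst.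
- near=> n => /=.
  have n0 : 0 < n%:R :> R by rewrite ltr0n; near: n; exact: nbhs_infty_gt.
  have hn : 0 <= h * n%:R by rewrite mulr_ge0// ltW.
  rewrite ler_pdivlMr// ler_pdivrMr// truncn_le hn andbT.
  rewrite mulrBl mulVf ?gt_eqF// lerBlDr natr1 ltW// truncnS_gt//.
- rewrite -[X in _ --> X]subr0; apply: cvgB; first exact: cvg_cst.
  by have := @cvg_div_natD 0 (lexx _); under eq_cvg do rewrite addr0.
Unshelve. all: by end_near. Qed.

Lemma cvgny_ratio (i : nat -> nat) (x : R) : 0 < x ->
  (fun n => (i n)%:R / n%:R) @ \oo --> x -> i @ \oo --> \oo.
Proof.
move=> x0 ix; apply/cvgnyPge => A; near=> n.
have n0 : 0 < n%:R :> R by rewrite ltr0n; near: n; exact: nbhs_infty_gt.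
have h1 : x / 2 < (i n)%:R / n%:R.
  by near: n; apply: (cvgr_gt x ix); lra.
have h2 : A%:R <= x / 2 * n%:R.
  rewrite -ler_pdivrMl ?divr_gt0//.
  by near: n; apply: nbhs_infty_ger; exact: num_real.
rewrite -(ler_nat R) (le_trans h2)// ltW//.
by rewrite -ltr_pdivlMr.
Unshelve. all: by end_near. Qed.

Lemma slowly_varying_cvg M (i : nat -> nat) (x : R) : (forall n, 0 < M n) ->
  slowly_varying M -> 0 < x -> (fun n => (i n)%:R / n%:R) @ \oo --> x ->
  (fun n => M (i n) / M n) @ \oo --> (1 : R).
Proof.
move=> M0 HM x0 ix; apply/cvgrPdistC_le => eta eta0.
have iy := cvgny_ratio x0 ix.
(* Eventually x/2 < i n / n < 2 x, so [i n] and n are comparable with this ratio. *)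
pose eps := Num.min (x / 2) (2 * x)^-1.
have e0 : 0 < eps by rewrite lt_min divr_gt0//= invr_gt0 mulr_gt0.
have [N HN] := HM _ _ e0 eta0.
near=> n.
have n0 : 0 < n%:R :> R by rewrite ltr0n; near: n; exact: nbhs_infty_gt.
have h1 : x / 2 < (i n)%:R / n%:R by near: n; apply: (cvgr_gt x ix); lra.
have h2 : (i n)%:R / n%:R < 2 * x by near: n; apply: (cvgr_lt x ix); lra.
have x2 : 0 < 2 * x by rewrite mulr_gt0.
suff h : `|M (i n) - M n| <= eta * M n.
  rewrite -[X in _ - X](@divff _ (M n)) ?gt_eqF// -mulrBl normrM.
  by rewrite [X in _ * X]gtr0_norm ?invr_gt0// ler_pdivrMr.
apply: HN.
- by near: n; move/cvgnyPge : iy; apply.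
- by near: n; exact: nbhs_infty_ge.
- apply: (@le_trans _ _ ((2 * x)^-1 * (i n)%:R)).
    by rewrite ler_wpM2r// ge_min lexx orbT.
  by rewrite ler_pdivrMl// -ler_pdivrMr// ltW.
- apply: (@le_trans _ _ (x / 2 * n%:R)).
    by rewrite ler_wpM2r// ge_min lexx.
  by rewrite -ler_pdivlMr// ltW.
Unshelve. all: by end_near. Qed.

Lemma slowly_varying_inv M : (forall n, 0 < M n) -> slowly_varying M ->
  slowly_varying (fun n => (M n)^-1).
Proof.
move=> M0 HM eps eta e0 eta0; have [N HN] := HM _ _ e0 eta0.
exists N => i j Ni Nj h1 h2; have Mi := M0 i; have Mj := M0 j.
have -> : (M i)^-1 - (M j)^-1 = (M j - M i) / (M i * M j).
  by field; rewrite !gt_eqF.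
rewrite normrM [X in _ * X]gtr0_norm ?invr_gt0 ?mulr_gt0//.
rewrite ler_pdivrMr ?mulr_gt0// (le_trans (HN j i Nj Ni h2 h1))//.
by rewrite le_eqVlt; apply/orP; left; apply/eqP; field; rewrite gt_eqF.
Qed.

(** Uniform slow variation survives asymptotic equivalence. The increments of [a] are not controlled
    here, so [slowly_varying_ratio] could not be applied to it. *)
Lemma slowly_varying_cvgM M a : (forall n, 0 < M n) -> slowly_varying M ->
  (fun n => M n * a n) @ \oo --> (1 : R) -> slowly_varying a.
Proof.
move=> M0 HM Ma eps eta e0 eta0.
pose w := Num.min (1 / 2) (eta / 20).
have w0 : 0 < w by rewrite lt_min !divr_gt0.
have w1 : w <= 1 / 2 by rewrite ge_min lexx.
have w2 : w <= eta / 20 by rewrite ge_min lexx orbT.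
have [N HN] := HM _ _ e0 w0.
have [N1 _ HN1] := (cvgrPdistC_le _ _).1 Ma _ w0.
exists (maxn N N1) => i j; rewrite !geq_max => /andP[Ni Ni1] /andP[Nj Nj1] h1 h2.
have /= := HN1 i Ni1; have /= := HN1 j Nj1; have := HN j i Nj Ni h2 h1.
have Mi := M0 i; have Mj := M0 j.
have aE n : a n = M n * a n / M n by field; rewrite gt_eqF.
rewrite !ler_norml => /andP[a1 a2] /andP[b1 b2] /andP[c1 c2].
rewrite (aE i) (aE j); move: (M i * a i) (M j * a j) b1 b2 c1 c2.
move=> yi yj b1 b2 c1 c2.
have -> : yi / M i - yj / M j = (yi * (M j / M i) - yj) / M j.
  by field; rewrite !gt_eqF.
have r1 : 1 - w <= M j / M i by rewrite ler_pdivlMr//; lra.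
have r2 : M j / M i <= 1 + w by rewrite ler_pdivrMr//; lra.
move: (M j / M i) r1 r2 => r r1 r2.
rewrite mulrA ler_pM2r ?invr_gt0// ler_pdivlMr// -mulNr -mulrA mulVf ?gt_eqF// mulr1.
have p1 : yi * r <= (1 + w) * (1 + w) by apply: ler_pM; lra.
have p2 : (1 - w) * (1 - w) <= yi * r by apply: ler_pM; lra.
have p3 : w * w <= w * (1 / 2) by rewrite ler_pM2l.
have p5 : 0 <= w * w by rewrite mulr_ge0// ltW.
have p4 : eta * (1 / 2) <= eta * yj by rewrite ler_pM2l//; lra.
apply/andP; split; lra.
Qed.

Lemma cvg_powR_nat_ratio (i : nat -> nat) (x rho : R) : 0 < x ->
  (fun n => (i n)%:R / n%:R) @ \oo --> x ->
  (fun n => ((i n)%:R / n%:R) `^ rho) @ \oo --> x `^ rho.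
Proof.
move=> x0 ix.
have cp : {for x, continuous (fun y : R => y `^ rho)}.
  apply: differentiable_continuous; apply/derivable1_diffP.
  by apply: derivable_powR; rewrite in_itv/= andbT.
exact: (cvg_comp _ _ ix cp).
Qed.

Lemma regularly_varying_cvg a M (i : nat -> nat) (x rho kappa : R) :
  (forall n, 0 < M n) -> slowly_varying M ->
  (fun n => a n / (M n * n%:R `^ rho)) @ \oo --> kappa ->
  0 < x -> (fun n => (i n)%:R / n%:R) @ \oo --> x ->
  (fun n => a (i n) / (M n * n%:R `^ rho)) @ \oo --> kappa * x `^ rho.
Proof.
move=> M0 HM ak x0 ix.
have iy := cvgny_ratio x0 ix.
have h1 : (fun n => a (i n) / (M (i n) * (i n)%:R `^ rho)) @ \oo --> kappa.
  exact: (cvg_comp _ _ iy ak).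
have h2 := slowly_varying_cvg M0 HM x0 ix.
have h3 := @cvg_powR_nat_ratio i x rho x0 ix.
have H : (fun n => a (i n) / (M (i n) * (i n)%:R `^ rho) * (M (i n) / M n) *
   ((i n)%:R / n%:R) `^ rho) @ \oo --> kappa * 1 * x `^ rho.
  by apply: cvgM h3; exact: cvgM.
rewrite mulr1 in H; apply: cvg_trans H; apply: near_eq_cvg; near=> n => /=.
have n0 : 0 < n%:R :> R by rewrite ltr0n; near: n; exact: nbhs_infty_gt.
have i0 : 0 < (i n)%:R :> R by rewrite ltr0n; near: n; move/cvgnyPgt : iy; apply.
have nr0 : 0 < n%:R `^ rho :> R by rewrite powR_gt0.
have E : (i n)%:R `^ rho = ((i n)%:R / n%:R) `^ rho * n%:R `^ rho.
  by rewrite -powRM ?divr_ge0// divfK// gt_eqF.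
rewrite E; have r0 : 0 < ((i n)%:R / n%:R) `^ rho :> R by rewrite powR_gt0// divr_gt0.
by field; rewrite !gt_eqF.
Unshelve. all: by end_near. Qed.
(** Truncation to polynomials makes convolution inherit commutativity and associativity from the
    polynomial ring. *)
Lemma conv_coefM p q n j : (j < n)%N ->
  Defs.conv p q j = (\poly_(i < n) p i * \poly_(i < n) q i)`_j.
Proof.
move=> jn; rewrite /Defs.conv coefM; apply: eq_bigr => i _; rewrite !coef_poly.
have ij : (i <= j)%N by rewrite -ltnS.
by rewrite (leq_ltn_trans ij jn) (leq_ltn_trans (leq_subr _ _) jn).
Qed.

Lemma convC p q n : Defs.conv p q n = Defs.conv q p n.
Proof. by rewrite !(@conv_coefM _ _ n.+1)// mulrC. Qed.

Lemma eq_conv p p' q q' n : (forall k, (k <= n)%N -> p k = p' k) ->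
  (forall k, (k <= n)%N -> q k = q' k) -> Defs.conv p q n = Defs.conv p' q' n.
Proof.
move=> pp qq; apply: eq_bigr => i _.
by rewrite pp ?qq ?leq_subr// -ltnS.
Qed.

Lemma convA p q r n : Defs.conv p (Defs.conv q r) n = Defs.conv (Defs.conv p q) r n.
Proof.
rewrite !(@conv_coefM _ _ n.+1)// !coefM.
transitivity ((\poly_(i < n.+1) p i * (\poly_(i < n.+1) q i * \poly_(i < n.+1) r i))`_n).
  rewrite coefM; apply: eq_bigr => j _; congr (_ * _).
  by rewrite coef_poly ltnS leq_subr (@conv_coefM _ _ n.+1)// ltnS leq_subr.
rewrite mulrA coefM; apply: eq_bigr => j _; congr (_ * _).
by rewrite coef_poly ltn_ord (@conv_coefM _ _ n.+1).
Qed.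

Lemma rising_bin1 n : rising_bin 1 n = 1 :> R.
Proof.
by rewrite /rising_bin big1// => k _; rewrite natr1 divff.
Qed.

Lemma rising_bin0 (x : R) : rising_bin x 0 = 1.
Proof. by rewrite /rising_bin big_ord0. Qed.

(* Multiplying the convolution by n + 1 = k + (n + 1 - k) and using
   (k + 1) a_(k+1)(x) = (x + k) a_k(x) turns the claim into an induction. *)
Lemma rising_bin_conv (x y : R) n :
  Defs.conv (rising_bin x) (rising_bin y) n = rising_bin (x + y) n.
Proof.
have S (z : R) k : k.+1%:R * rising_bin z k.+1 = (z + k%:R) * rising_bin z k.
  by rewrite rising_binS mulrC -mulrA divfK// mulrC addrC.
elim: n => [|n IH]; first by rewrite /Defs.conv big_ord1 !rising_bin0 mulr1.
have n0 : (n.+1%:R : R) != 0 by [].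
apply: (mulfI n0); rewrite S -IH {1}/Defs.conv mulr_sumr.
have E (k : 'I_n.+2) : n.+1%:R * (rising_bin x k * rising_bin y (n.+1 - k)) =
    k%:R * rising_bin x k * rising_bin y (n.+1 - k) +
    rising_bin x k * ((n.+1 - k)%N%:R * rising_bin y (n.+1 - k)) :> R.
  have kn : (k <= n.+1)%N by rewrite -ltnS.
  have -> : n.+1%:R = k%:R + (n.+1 - k)%N%:R :> R by rewrite -natrD subnKC.
  by move: (_ - _)%N%:R => d; ring.
under eq_bigr do rewrite E.
rewrite big_split/= big_ord_recl/= mul0r mul0r add0r.
rewrite [X in _ + X]big_ord_recr/= subnn mul0r mulr0 addr0 -big_split/=.
rewrite /Defs.conv mulr_sumr; apply: eq_bigr => k _.
have kn : (k <= n)%N by rewrite -ltnS.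
rewrite /bump/= add1n S subSS (subSn kn) S natrB//; ring.
Qed.

(** Together with [rising_bin_conv] at 1, this is the closed form of the partial sums of
    [rising_bin x]. *)
Lemma rising_binDl (x : R) n : x != 0 ->
  rising_bin (1 + x) n = rising_bin x n * ((n%:R + x) / x).
Proof.
move=> x0; elim: n => [|n IH]; first by rewrite !rising_bin0 add0r divff// mulr1.
rewrite !rising_binS IH -[n.+1%:R]natr1; field.
by rewrite natr1 pnatr_eq0 x0.
Qed.

Lemma rising_bin_dec (x : R) m n : 0 < x <= 1 -> (m <= n)%N ->
  rising_bin x n <= rising_bin x m.
Proof.
move=> /andP[x0 x1]; elim: n => [|n IH]; first by rewrite leqn0 => /eqP->.
rewrite leq_eqVlt => /predU1P[->//|]; rewrite ltnS => mn.
apply: le_trans (IH mn); rewrite rising_binS ger_pMr ?rising_bin_gt0//.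
by rewrite ler_pdivrMr// mul1r -natr1 lerD2l.
Qed.

Lemma rising_bin_ratio (x : R) : 0 < x <= 1 ->
  (fun n => n%:R * (1 - rising_bin x n.+1 / rising_bin x n)) @ \oo --> 1 - x.
Proof.
move=> /andP[x0 x1].
have : (fun n => (1 - x) * (n%:R / (n%:R + 1))) @ \oo --> (1 - x) * 1.
  by apply: cvgMl_tmp; exact: cvg_nat_divD.
rewrite mulr1; apply: cvg_trans; apply: near_eq_cvg; near=> n.
have := @rising_bin_gt0 R x n x0; rewrite rising_binS => h.
by rewrite -[n.+1%:R]natr1; field; rewrite gt_eqF//= natr1 pnatr_eq0.
Unshelve. all: by end_near. Qed.
Lemma partial_sum_rising_bin_le (x : R) : 0 < x <= 1 ->
  exists (C : R) N, 0 < C /\ forall n, (N <= n)%N ->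
    \sum_(k < n.+1) rising_bin x k <= C * n.+1%:R * rising_bin x n.
Proof.
move=> /andP[x0 x1]; apply: (@partial_sum_le _ (1 - x)).
- by move=> n; exact: rising_bin_gt0.
- by rewrite subr_ge0 x1 gtrBl.
- by apply: rising_bin_ratio; rewrite x0.
Qed.

(** * The renewal equation: from regular variation of u to that of v *)

Section renewal.
Context (delta : R) (u v : nat -> R).
Context (delta01 : 0 < delta < 1) (u0 : forall n, 0 < u n)
  (v0 : forall n, 0 <= v n) (vdec : forall m n, (m <= n)%N -> v n <= v m)
  (uv1 : forall n, Defs.conv u v n = 1)
  (u_ratio : (fun n => n%:R * (1 - u n.+1 / u n)) @ \oo --> delta).

(* The renewal sequence with generating function (1 - z)^(delta - 1) is the
   exactly solvable model; L is the slowly varying correction to it. *)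
Let L n := u n / rising_bin (1 - delta) n.

Let delta0 : 0 < delta. Proof. by case/andP: delta01. Qed.
Let delta1 : delta < 1. Proof. by case/andP: delta01. Qed.
Let cdelta0 : 0 < 1 - delta. Proof. by rewrite subr_gt0. Qed.
Let cdelta01 : 0 < 1 - delta <= 1.
Proof. by rewrite cdelta0 gerBl ltW. Qed.
Let cdelta01' : 0 < 1 - delta < 1.
Proof. by rewrite cdelta0 gtrBl. Qed.

Lemma renewal_L_gt0 n : 0 < L n.
Proof. by rewrite divr_gt0// rising_bin_gt0. Qed.

Lemma renewal_L_ratio : (fun n => n%:R * (1 - L n.+1 / L n)) @ \oo --> (0 : R).
Proof.
have h1 : (fun n => n%:R / (n%:R + (1 - delta))) @ \oo --> (1 : R).
  by apply: cvg_nat_divD; exact: ltW.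
have h2 : (fun n => (n%:R + (1 - delta))^-1) @ \oo --> (0 : R).
  by apply: cvg_div_natD; exact: ltW.
(* An exact decomposition: consecutive ratios of the model are (n + 1 - delta) / (n + 1), so the
   limits delta cancel. *)
have H : (fun n => (n%:R * (1 - u n.+1 / u n) - delta) * (n%:R / (n%:R + (1 - delta))) +
    n%:R * (1 - u n.+1 / u n) * (n%:R + (1 - delta))^-1) @ \oo -->
    (delta - delta) * 1 + delta * 0.
  apply: cvgD; last exact: cvgM.
  by apply: cvgM => //; apply: cvgB => //; exact: cvg_cst.
rewrite subrr mul0r mulr0 addr0 in H; apply: cvg_trans H; apply: near_eq_cvg; near=> n.
have n0 : 0 < n%:R :> R by rewrite ltr0n; near: n; exact: nbhs_infty_gt.
rewrite /L rising_binS -[n.+1%:R]natr1.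
have := @rising_bin_gt0 R _ n cdelta0; move: (rising_bin _ n) => q q0.
have := u0 n; move: (u n) (u n.+1) => un un1 un0.
have nd0 : 0 < n%:R + (1 - delta) by rewrite addr_gt0.
have n10 : 0 < n%:R + 1 :> R by rewrite addr_gt0.
by field; rewrite !gt_eqF.
Unshelve. all: by end_near. Qed.

Lemma renewal_L_slowly_varying : slowly_varying L.
Proof. exact: slowly_varying_ratio renewal_L_gt0 renewal_L_ratio. Qed.

Let v00 : 0 < v 0.
Proof.
have := uv1 0; rewrite /Defs.conv big_ord1 subnn => h.
have : 0 < u 0 * v 0 by rewrite h.
by rewrite pmulr_rgt0.
Qed.

Let X n := Defs.conv (rising_bin (1 - delta)) v n.

Let LX : (fun n => L n * X n) @ \oo --> (1 : R).
Proof.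
have := @slowly_varying_conv L (rising_bin (1 - delta)) v renewal_L_gt0
  renewal_L_slowly_varying _ _ v0 vdec v00 _ _ _.
have E n : L n * rising_bin (1 - delta) n = u n.
  by rewrite /L divfK// gt_eqF// rising_bin_gt0.
(* Since L times the model is u, the numerator is u * v = 1 and the denominator is L X. *)
have -> : (fun n => (\sum_(k < n.+1) L k * rising_bin (1 - delta) k * v (n - k)%N) /
   (L n * (\sum_(k < n.+1) rising_bin (1 - delta) k * v (n - k)%N))) =
   (fun n => (L n * X n)^-1).
  apply/funext => n; rewrite -[RHS]mul1r; congr (_ / _).
  rewrite -[RHS](uv1 n); by apply: eq_bigr => k _; rewrite E.
move=> H; have {}H : (fun n => (L n * X n)^-1) @ \oo --> (1 : R).
  apply: H.
  - by move=> n; exact: rising_bin_gt0.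
  - by move=> m n; exact: rising_bin_dec.
  - exact: partial_sum_rising_bin_le.
  - have [C [N [C0 HN]]] := @partial_sum_le u delta u0 (introT andP (conj (ltW delta0) delta1)) u_ratio.
    exists C, N; split => // n Nn; rewrite E.
    by under eq_bigr do rewrite E; exact: HN.
  - apply: (@powR_asymp_block _ delta (Gamma (1 - delta))^-1).
    + by rewrite ltW.
    + by rewrite invr_gt0 Gamma_gt0.
    + by move=> n; exact: rising_bin_gt0.
    + by have := rising_bin_Gamma cdelta01'; rewrite subKr.
have K : (fun n => ((L n * X n)^-1)^-1) @ \oo --> (1 : R).
  by rewrite -[Y in _ --> Y]invr1; apply: cvgV => //; exact: oner_neq0.
by apply: cvg_trans K; apply: near_eq_cvg; apply: nearW => n; rewrite invrK.
Qed.

Let X0 n : 0 < X n.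
Proof.
rewrite /X /Defs.conv big_ord_recr/= subnn ltr_wpDl ?mulr_gt0 ?rising_bin_gt0//.
by rewrite sumr_ge0// => k _; rewrite mulr_ge0// ltW// rising_bin_gt0.
Qed.

Let V n := \sum_(k < n.+1) v k.

(* The model sequences are convolution inverse to each other up to the
   constant sequence 1, which undoes the first convolution. *)
Let V_conv n : V n = Defs.conv X (rising_bin delta) n.
Proof.
transitivity (Defs.conv v (rising_bin 1) n).
  by apply: eq_bigr => k _; rewrite rising_bin1 mulr1.
transitivity (Defs.conv v (Defs.conv (rising_bin (1 - delta)) (rising_bin delta)) n).
  by apply: eq_conv => // k _; rewrite rising_bin_conv subrK.
rewrite convA; apply: eq_conv => // k _; exact: convC.
Qed.

Let invL_ratio : (fun n => n%:R * (1 - (L n.+1)^-1 / (L n)^-1)) @ \oo --> (0 : R).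
Proof.
have h : (fun n => n%:R * (1 - L n.+1 / L n) * n%:R^-1) @ \oo --> (0 * 0 : R).
  apply: cvgM; first exact: renewal_L_ratio.
  by have := @cvg_div_natD 0 (lexx _); under eq_cvg do rewrite addr0.
have r : (fun n => 1 - n%:R * (1 - L n.+1 / L n) * n%:R^-1) @ \oo --> (1 - 0 * 0 : R).
  by apply: cvgB => //; exact: cvg_cst.
have H : (fun n => - (n%:R * (1 - L n.+1 / L n)) *
    (1 - n%:R * (1 - L n.+1 / L n) * n%:R^-1)^-1) @ \oo --> (- 0 * (1 - 0 * 0)^-1 : R).
  apply: cvgM; first by apply: cvgN; exact: renewal_L_ratio.
  by apply: cvgV r; rewrite mulr0 subr0 oner_neq0.
rewrite oppr0 mul0r in H; apply: cvg_trans H; apply: near_eq_cvg; near=> n.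
have n0 : 0 < n%:R :> R by rewrite ltr0n; near: n; exact: nbhs_infty_gt.
have := renewal_L_gt0 n; have := renewal_L_gt0 n.+1.
move: (L n) (L n.+1) => l l' l'0 l0.
rewrite mulrAC divff ?gt_eqF// mul1r subKr.
by field; rewrite !gt_eqF.
Unshelve. all: by end_near. Qed.

(** X is known only through L X --> 1, so the bound is carried over from 1 / L: X <= b / L
    everywhere and 1 / L <= 2 X eventually. The factors 1 match [slowly_varying_conv] with p
    constant. *)
Let partial_sum_X : exists (C : R) N, 0 < C /\ forall n, (N <= n)%N ->
  \sum_(k < n.+1) X k * 1 <= C * n.+1%:R * (X n * 1).
Proof.
have iL0 n : 0 < (L n)^-1 by rewrite invr_gt0 renewal_L_gt0.
have [C [N [C0 HN]]] := @partial_sum_le (fun n => (L n)^-1) 0 iL0 (introT andP (conj (lexx _) ltr01)) invL_ratio.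
have [B [Br HB]] := cvg_seq_bounded (cvgP _ LX).
have b1 : B < Num.max 1 (B + 1) by rewrite lt_max ltrDl ltr01 orbT.
set b := Num.max 1 (B + 1) in b1.
have b0 : 0 < b by rewrite lt_max ltr01.
have Xb k : X k <= b * (L k)^-1.
  rewrite ler_pdivlMr ?renewal_L_gt0// mulrC (le_trans (ler_norm _))//.
  exact: (HB _ b1).
have h12 : 1 / 2 < 1 :> R by lra.
have [N1 _ HN1] := cvgr_gt _ LX _ h12.
exists (2 * b * C), (maxn N N1); split; first by rewrite !mulr_gt0.
move=> n; rewrite geq_max => /andP[Nn Nn1].
apply: (@le_trans _ _ (b * \sum_(k < n.+1) (L k)^-1)).
  by rewrite mulr_sumr; apply: ler_sum => k _; rewrite mulr1.
apply: (@le_trans _ _ (b * (C * n.+1%:R * (L n)^-1))).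
  by rewrite ler_pM2l// HN.
rewrite mulr1 (_ : 2 * b * C * _ * _ = b * (C * n.+1%:R * (2 * X n))); last by ring.
rewrite ler_pM2l// ler_pM2l ?mulr_gt0//.
have := HN1 n Nn1 => /= h.
by rewrite -[leLHS]mul1r ler_pdivrMr ?renewal_L_gt0//; lra.
Qed.

(** A second use of [slowly_varying_conv], with X as the slowly varying factor and p = 1. The
    remaining sum is [rising_bin (1 + delta)], and delta Gamma(delta) = Gamma(1 + delta). *)
Let LV : (fun n => V n / ((L n)^-1 * n%:R `^ delta)) @ \oo --> (delta * Gamma delta)^-1.
Proof.
have H : (fun n => V n / (X n * \sum_(k < n.+1) 1 * rising_bin delta (n - k)%N)) @ \oo --> (1 : R).
  have -> : (fun n => V n / (X n * \sum_(k < n.+1) 1 * rising_bin delta (n - k)%N)) =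
      (fun n => (\sum_(k < n.+1) X k * 1 * rising_bin delta (n - k)%N) /
                (X n * \sum_(k < n.+1) 1 * rising_bin delta (n - k)%N)).
    apply/funext => n; rewrite V_conv; congr (_ / _).
    by apply: eq_bigr => k _; rewrite mulr1.
  apply: (@slowly_varying_conv X (fun=> 1) (rising_bin delta)) => //.
  - exact: slowly_varying_cvgM renewal_L_gt0 renewal_L_slowly_varying LX.
  - by move=> n; rewrite ltW// rising_bin_gt0.
  - by move=> m n; apply: rising_bin_dec; rewrite delta0 ltW.
  - by rewrite rising_bin_gt0.
  - exists 1, 0; split => // n _.
    by rewrite sumr_const card_ord mul1r mulr1.
  - apply: (@powR_asymp_block _ 0 1) => //; first by rewrite lexx ltr01.
    by under eq_cvg do rewrite powRr0 mulr1; exact: cvg_cst.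
have S n : \sum_(k < n.+1) 1 * rising_bin delta (n - k)%N =
    rising_bin delta n * ((n%:R + delta) / delta).
  rewrite -rising_binDl ?gt_eqF// -rising_bin_conv.
  by apply: eq_bigr => k _; rewrite rising_bin1.
have h1 : (fun n => n%:R `^ (1 - delta) * rising_bin delta n) @ \oo --> (Gamma delta)^-1.
  exact: rising_bin_Gamma.
have h2 : (fun n => (n%:R / (n%:R + delta))^-1) @ \oo --> (1^-1 : R).
  by apply: cvgV; [exact: oner_neq0|apply: cvg_nat_divD; exact: ltW].
have K : (fun n => V n / (X n * \sum_(k < n.+1) 1 * rising_bin delta (n - k)%N) *
   (L n * X n) * (n%:R `^ (1 - delta) * rising_bin delta n) *
   (n%:R / (n%:R + delta))^-1 / delta) @ \oo --> 1 * 1 * (Gamma delta)^-1 * 1^-1 / delta.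
  by apply: cvgMr_tmp; apply: cvgM => //; apply: cvgM => //; apply: cvgM.
rewrite mulr1 mul1r invr1 mulr1 -invfM mulrC in K.
apply: cvg_trans K; apply: near_eq_cvg; near=> n.
have n0 : 0 < n%:R :> R by rewrite ltr0n; near: n; exact: nbhs_infty_gt.
rewrite S.
have := X0 n; have := renewal_L_gt0 n; have := @rising_bin_gt0 R _ n delta0.
have : 0 < n%:R `^ delta :> R by rewrite powR_gt0.
have -> : n%:R `^ (1 - delta) = n%:R / n%:R `^ delta :> R.
  by rewrite powRB ?powRr1// (gt_eqF n0) implybT.
have : 0 < n%:R + delta by rewrite addr_gt0.
move: (n%:R + delta) (n%:R `^ delta) (rising_bin delta n) (L n) (X n).
move=> a p q l x a0 p0 q0 l0 x0.
by field; rewrite !gt_eqF.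
Unshelve. all: by end_near. Qed.

(** Write t^delta = t / t^(1 - delta) and bound the denominator by its tangent. At t = 1 + h and t =
    1 - h this controls the difference quotients of V without differentiation. *)
Let powR_ge_tangent (t : R) : 0 < t -> 1 + delta * (t - 1) / t <= t `^ delta.
Proof.
move=> t0; have := @powR_le_tangent R (1 - delta) t (ltW t0) cdelta01'.
have E : t = t `^ delta * t `^ (1 - delta).
  rewrite -powRD; last by rewrite (gt_eqF t0) implybT.
  by rewrite [delta + _]addrC subrK powRr1// ltW.
have : 0 < t `^ delta by rewrite powR_gt0.
have : 0 < t `^ (1 - delta) by rewrite powR_gt0.
move: (t `^ delta) (t `^ (1 - delta)) E => s q E q0 s0 hq.
have d2 : 0 <= delta * (t - 1) * (delta * (t - 1)) by rewrite -expr2 sqr_ge0.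
have h : (t + delta * (t - 1)) * (t - delta * (t - 1)) <= t * t by nra.
have q1 : 0 < t - delta * (t - 1) by apply: lt_le_trans q0 _; apply: le_trans hq _; lra.
have h2 : t * t <= t * s * (t - delta * (t - 1)).
  rewrite {2}E -mulrA ler_pM2l// ler_pM2l//; apply: le_trans hq _; lra.
have h3 : t + delta * (t - 1) <= t * s by rewrite -(ler_pM2r q1) (le_trans h).
rewrite [leLHS](_ : _ = (t + delta * (t - 1)) / t); last by field; rewrite gt_eqF.
by rewrite ler_pdivrMr// [s * t]mulrC.
Qed.

Let Linv0 n : 0 < (L n)^-1.
Proof. by rewrite invr_gt0 renewal_L_gt0. Qed.

Let Linv_slowly_varying : slowly_varying (fun n => (L n)^-1).
Proof. exact: slowly_varying_inv renewal_L_gt0 renewal_L_slowly_varying. Qed.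

Let V_sub m n : (m <= n)%N -> V n - V m = \sum_(m.+1 <= k < n.+1) v k.
Proof.
move=> mn; rewrite /V -!(big_mkord xpredT v) (@big_cat_nat _ _ _ m.+1)//.
by rewrite [X in X - _]addrC addrK.
Qed.

Let V_sub_le m n : (m <= n)%N -> V n - V m <= (n - m)%N%:R * v m.
Proof.
move=> mn; rewrite V_sub//; apply: (@le_trans _ _ (\sum_(m.+1 <= k < n.+1) v m)).
  by rewrite !big_nat; apply: ler_sum => k /andP[mk _]; rewrite vdec// ltnW.
by rewrite big_const_nat iter_addr_0 subSS mulr_natl.
Qed.

Let V_sub_ge m n : (m <= n)%N -> (n - m)%N%:R * v n <= V n - V m.
Proof.
move=> mn; rewrite V_sub//; apply: (@le_trans _ _ (\sum_(m.+1 <= k < n.+1) v n)).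
  by rewrite big_const_nat iter_addr_0 subSS mulr_natl.
by rewrite !big_nat; apply: ler_sum => k /andP[_ kn]; rewrite vdec// -ltnS.
Qed.

Let W n := v n / ((L n)^-1 * n%:R `^ (delta - 1)).

Let W_mul (m : R) n : (0 < n)%N -> m * v n / ((L n)^-1 * n%:R `^ delta) = m / n%:R * W n.
Proof.
move=> n0; rewrite /W; have nR : 0 < n%:R :> R by rewrite ltr0n.
rewrite powRB ?powRr1//; last by rewrite (gt_eqF nR) implybT.
have := renewal_L_gt0 n; have : 0 < n%:R `^ delta :> R by rewrite powR_gt0.
by move: (L n) (n%:R `^ delta) => l p p0 l0; field; rewrite !gt_eqF.
Qed.

Let Gdelta : 0 < Gamma delta. Proof. exact: Gamma_gt0. Qed.

Let V_diff_cvg (i : nat -> nat) (x : R) : 0 < x ->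
  (fun n => (i n)%:R / n%:R) @ \oo --> x ->
  (fun n => (V (i n) - V n) / ((L n)^-1 * n%:R `^ delta)) @ \oo -->
    (delta * Gamma delta)^-1 * (x `^ delta - 1).
Proof.
move=> x0 ix; have := regularly_varying_cvg Linv0 Linv_slowly_varying LV x0 ix.
move=> /cvgB/(_ LV); rewrite mulrBr mulr1; apply: cvg_trans; apply: near_eq_cvg.
by apply: nearW => n; rewrite mulrBl.
Qed.

(* Monotone density: compare V over [n, (1 + h) n], and below over [(1 - h) n, n]. *)
Let W_lower (e : R) : 0 < e -> \forall n \near \oo, (Gamma delta)^-1 - e < W n.
Proof.
(* [powR_ge_tangent] bounds the limiting quotient below by 1 / (Gamma(delta) (1 + h)), which this h
   keeps above 1 / Gamma(delta) - e. *)
move=> e0; pose h := Num.min (1 / 2) (e * Gamma delta).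
have h0 : 0 < h by rewrite lt_min divr_gt0//= mulr_gt0.
have he : h <= e * Gamma delta by rewrite ge_min lexx orbT.
pose m n := Num.truncn (h * n%:R).
have mh : (fun n => (m n)%:R / n%:R) @ \oo --> h by exact: cvg_truncn_div.
have ih : (fun n => (n + m n)%N%:R / n%:R) @ \oo --> 1 + h.
  have : (fun n => 1 + (m n)%:R / n%:R) @ \oo --> 1 + h.
    by apply: cvgD => //; exact: cvg_cst.
  apply: cvg_trans; apply: near_eq_cvg; near=> n.
  have n0 : n%:R != 0 :> R by rewrite pnatr_eq0 -lt0n; near: n; exact: nbhs_infty_gt.
  by rewrite natrD mulrDl divff.
have h1 : 0 < 1 + h by rewrite addr_gt0.
have D := V_diff_cvg h1 ih.
have Q : (fun n => (V (n + m n)%N - V n) / ((L n)^-1 * n%:R `^ delta) / ((m n)%:R / n%:R))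
    @ \oo --> (delta * Gamma delta)^-1 * ((1 + h) `^ delta - 1) / h.
  by apply: cvgM D _; apply: cvgV mh; rewrite gt_eqF.
have lim : (Gamma delta)^-1 - e < (delta * Gamma delta)^-1 * ((1 + h) `^ delta - 1) / h.
  apply: (@lt_le_trans _ _ ((delta * Gamma delta)^-1 * (delta * h / (1 + h)) / h)).
    rewrite [ltRHS](_ : _ = (Gamma delta)^-1 / (1 + h)); last by field; rewrite !gt_eqF.
    rewrite ltr_pdivlMr// mulrBl mulrDr mulr1 -addrA gtrDl subr_lt0.
    apply: (@le_lt_trans _ _ (e * 1)); last by rewrite ltr_pM2l// ltrDl.
    by rewrite mulr1 ler_pdivrMl// mulrC.
  rewrite ler_pM2r ?invr_gt0// ler_pM2l ?invr_gt0 ?mulr_gt0//.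
  have := powR_ge_tangent h1; rewrite addrAC subrr add0r.
  by rewrite lerBrDl.
have mpos : \forall n \near \oo, 0 < (m n)%:R / n%:R :> R by apply: (cvgr_gt h mh).
near=> n.
have n0 : (0 < n)%N by near: n; exact: nbhs_infty_gt.
have m0 : 0 < (m n)%:R / n%:R :> R by near: n.
apply: (@lt_le_trans _ _ ((V (n + m n)%N - V n) / ((L n)^-1 * n%:R `^ delta) / ((m n)%:R / n%:R))).
  by near: n; exact: (cvgr_gt _ Q).
rewrite ler_pdivrMr// [W n * _]mulrC -W_mul// ler_pM2r; last first.
  by rewrite invr_gt0 mulr_gt0// powR_gt0// ltr0n.
by have := V_sub_le (leq_addr (m n) n); rewrite addKn.
Unshelve. all: by end_near. Qed.

Let W_upper (e : R) : 0 < e -> \forall n \near \oo, W n < (Gamma delta)^-1 + e.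
Proof.
move=> e0; pose h := Num.min (1 / 2) (e * Gamma delta / 4).
have h0 : 0 < h by rewrite lt_min divr_gt0//= divr_gt0// mulr_gt0.
have he : h <= e * Gamma delta / 4 by rewrite ge_min lexx orbT.
have h12 : h <= 1 / 2 by rewrite ge_min lexx.
pose m n := Num.truncn (h * n%:R).
have mn n : (m n <= n)%N.
  rewrite -(ler_nat R) (@le_trans _ _ (h * n%:R))//.
    by rewrite truncn_le// mulr_ge0// ltW.
  by rewrite ler_piMl//; lra.
have mh : (fun n => (m n)%:R / n%:R) @ \oo --> h by exact: cvg_truncn_div.
have ih : (fun n => (n - m n)%N%:R / n%:R) @ \oo --> 1 - h.
  have : (fun n => 1 - (m n)%:R / n%:R) @ \oo --> 1 - h.
    by apply: cvgB => //; exact: cvg_cst.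
  apply: cvg_trans; apply: near_eq_cvg; near=> n.
  have n0 : n%:R != 0 :> R by rewrite pnatr_eq0 -lt0n; near: n; exact: nbhs_infty_gt.
  by rewrite natrB// mulrBl divff.
have h1 : 0 < 1 - h by lra.
have D := V_diff_cvg h1 ih.
have Q : (fun n => - ((V (n - m n)%N - V n) / ((L n)^-1 * n%:R `^ delta)) / ((m n)%:R / n%:R))
    @ \oo --> - ((delta * Gamma delta)^-1 * ((1 - h) `^ delta - 1)) / h.
  by apply: cvgM; [exact: cvgN|apply: cvgV mh; rewrite gt_eqF].
have lim : - ((delta * Gamma delta)^-1 * ((1 - h) `^ delta - 1)) / h < (Gamma delta)^-1 + e.
  apply: (@le_lt_trans _ _ ((delta * Gamma delta)^-1 * (delta * h / (1 - h)) / h)).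
    rewrite ler_pM2r ?invr_gt0// -mulrN ler_pM2l ?invr_gt0 ?mulr_gt0// opprB.
    have := powR_ge_tangent h1.
    rewrite (_ : delta * (1 - h - 1) / (1 - h) = - (delta * h / (1 - h))).
      by move: (delta * h / (1 - h)) => z; lra.
    by field; rewrite gt_eqF.
  rewrite [ltLHS](_ : _ = (Gamma delta)^-1 / (1 - h)); last by field; rewrite !gt_eqF.
  rewrite ltr_pdivrMr//.
  have g0 : 0 < (Gamma delta)^-1 by rewrite invr_gt0.
  have : (Gamma delta)^-1 * h <= e / 4 by rewrite ler_pdivrMl//; lra.
  have : e * h <= e * (1 / 2) by rewrite ler_pM2l.
  move: (Gamma delta)^-1 g0 => g g0; nra.
have mpos : \forall n \near \oo, 0 < (m n)%:R / n%:R :> R by apply: (cvgr_gt h mh).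
near=> n.
have n0 : (0 < n)%N by near: n; exact: nbhs_infty_gt.
have m0 : 0 < (m n)%:R / n%:R :> R by near: n.
apply: (@le_lt_trans _ _ (- ((V (n - m n)%N - V n) / ((L n)^-1 * n%:R `^ delta)) / ((m n)%:R / n%:R))); last first.
  by near: n; exact: (cvgr_lt _ Q).
rewrite ler_pdivlMr// [W n * _]mulrC -W_mul// -mulNr opprB ler_pM2r; last first.
  by rewrite invr_gt0 mulr_gt0// powR_gt0// ltr0n.
by have := V_sub_ge (leq_subr (m n) n); rewrite subKn.
Unshelve. all: by end_near. Qed.

Let W_cvg : W @ \oo --> (Gamma delta)^-1.
Proof.
apply/cvgrPdistC_lt => e e0; near=> n.
rewrite ltr_norml; apply/andP; split.
  by rewrite ltrBrDl; near: n; exact: W_lower.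
by rewrite ltrBlDl; near: n; exact: W_upper.
Unshelve. all: by end_near. Qed.

Let u_cvg : (fun n => u n / (L n * n%:R `^ (- delta))) @ \oo --> (Gamma (1 - delta))^-1.
Proof.
have := rising_bin_Gamma cdelta01'; rewrite subKr.
apply: cvg_trans; apply: near_eq_cvg; near=> n.
have nR : 0 < n%:R :> R by rewrite ltr0n; near: n; exact: nbhs_infty_gt.
rewrite /L powRN; have := u0 n; have := @rising_bin_gt0 R _ n cdelta0.
have : 0 < n%:R `^ delta :> R by rewrite powR_gt0.
move: (rising_bin _ n) (u n) (n%:R `^ delta) => q w p p0 q0 w0.
by field; rewrite !gt_eqF.
Unshelve. all: by end_near. Qed.

Theorem renewal_product_cvg (i j : nat -> nat) (x y : R) : 0 < x -> 0 < y ->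
  (fun n => (i n)%:R / n%:R) @ \oo --> x ->
  (fun n => (j n)%:R / n%:R) @ \oo --> y ->
  (fun n => n%:R * (u (i n) * v (j n))) @ \oo -->
    (Gamma delta * Gamma (1 - delta) * x `^ delta * y `^ (1 - delta))^-1.
Proof.
move=> x0 y0 ix jy.
have h1 := regularly_varying_cvg renewal_L_gt0 renewal_L_slowly_varying u_cvg x0 ix.
have h2 := regularly_varying_cvg Linv0 Linv_slowly_varying W_cvg y0 jy.
(* Both factors are normalised at the same n: L cancels, and the exponents -delta and delta - 1 add
   up to -1. *)
have H : (fun n => u (i n) / (L n * n%:R `^ (- delta)) *
   (v (j n) / ((L n)^-1 * n%:R `^ (delta - 1)))) @ \oo -->
   (Gamma (1 - delta))^-1 * x `^ (- delta) * ((Gamma delta)^-1 * y `^ (delta - 1)).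
  exact: cvgM h1 h2.
have -> : (Gamma delta * Gamma (1 - delta) * x `^ delta * y `^ (1 - delta))^-1 =
   (Gamma (1 - delta))^-1 * x `^ (- delta) * ((Gamma delta)^-1 * y `^ (delta - 1)).
  by rewrite !invfM -!powRN opprB; ring.
apply: cvg_trans H; apply: near_eq_cvg; near=> n.
have nR : 0 < n%:R :> R by rewrite ltr0n; near: n; exact: nbhs_infty_gt.
rewrite powRN powRB ?powRr1//; last by rewrite (gt_eqF nR) implybT.
have := renewal_L_gt0 n; have : 0 < n%:R `^ delta :> R by rewrite powR_gt0.
move: (L n) (n%:R `^ delta) => l p p0 l0; field; rewrite !gt_eqF//.
Unshelve. all: by end_near. Qed.

End renewal.

End regular_variation.
(** * Generating functions near 1 *)

Section mean.
Context {R : realType} (mu : probability nat R).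
Implicit Types (phi psi : nat -> R) (s x y : R).

Let m := mass mu.

Lemma mass_ge0 n : 0 <= m n.
Proof. by rewrite fine_ge0. Qed.

Lemma EFin_mass n : (m n)%:E = mu [set n].
Proof. by rewrite /m /mass fineK// fin_num_measure. Qed.

Lemma nneseries_mass : (\sum_(0 <= n <oo) (m n)%:E)%E = 1%E :> \bar R.
Proof.
rewrite -(@probability_setT _ _ _ mu).
have -> : [set: nat] = \bigcup_n [set n] by apply/seteqP; split => // n _; exists n.
rewrite measure_semi_bigcup//=.
  by apply: eq_eseriesr => n _; rewrite EFin_mass.
by move=> i j _ _ [k /= [<- <-]].
Qed.

Lemma cvg_series_mass : series m @ \oo --> (1 : R).
Proof.
have h : (fun n => (series m n)%:E) @ \oo --> 1%E.
  rewrite -nneseries_mass; apply: cvg_trans (is_cvg_nneseries _).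
    by apply: near_eq_cvg; apply: nearW => n; rewrite /series/= sumEFin.
  by move=> n _ _; rewrite lee_fin mass_ge0.
by have [_] := (fine_cvgP _ _).1 h.
Qed.

(** A generating function is the mean of n |-> s^n, so its inequalities reduce to pointwise ones in
    n. *)
Definition mean phi : R := limn (series (fun n => phi n * m n)).

Definition bounded_nneg phi := exists C : R, forall n, 0 <= phi n <= C.

Lemma is_cvg_mean phi : bounded_nneg phi -> cvgn (series (fun n => phi n * m n)).
Proof.
move=> [C HC]; apply: (@series_le_cvg _ _ (fun n => C * m n)).
- by move=> n; have /andP[h _] := HC n; rewrite mulr_ge0// mass_ge0.
- move=> n; have /andP[h1 h2] := HC n.
  by rewrite mulr_ge0// ?mass_ge0// (le_trans h1).
- by move=> n; have /andP[h1 h2] := HC n; rewrite ler_wpM2r// mass_ge0.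
- by have := @is_cvg_seriesZ _ m C (cvgP _ cvg_series_mass).
Qed.

Lemma le_mean phi psi : bounded_nneg phi -> bounded_nneg psi ->
  (forall n, phi n <= psi n) -> mean phi <= mean psi.
Proof.
move=> b1 b2 h; apply: lim_series_le; [exact: is_cvg_mean..|] => n.
by rewrite ler_wpM2r// mass_ge0.
Qed.

Lemma bounded_nneg_cst C : 0 <= C -> bounded_nneg (fun=> C).
Proof. by move=> C0; exists C => n; rewrite C0 lexx. Qed.

Lemma bounded_nnegD phi psi : bounded_nneg phi -> bounded_nneg psi ->
  bounded_nneg (fun n => phi n + psi n).
Proof.
move=> [C HC] [D HD]; exists (C + D) => n.
by have /andP[? ?] := HC n; have /andP[? ?] := HD n; rewrite addr_ge0//= lerD.
Qed.

Lemma bounded_nnegZ c phi : 0 <= c -> bounded_nneg phi ->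
  bounded_nneg (fun n => c * phi n).
Proof.
move=> c0 [C HC]; exists (c * C) => n.
by have /andP[? ?] := HC n; rewrite mulr_ge0//= ler_wpM2l.
Qed.

Lemma bounded_nnegX s : 0 <= s <= 1 -> bounded_nneg (fun n => s ^+ n).
Proof. by move=> /andP[s0 s1]; exists 1 => n; rewrite exprn_ge0//= exprn_ile1. Qed.

Lemma bounded_nneg_eq0 : bounded_nneg (fun n => (n == 0)%:R).
Proof. by exists 1 => n; rewrite ler0n lern1 leq_b1. Qed.

Lemma meanD phi psi : bounded_nneg phi -> bounded_nneg psi ->
  mean (fun n => phi n + psi n) = mean phi + mean psi.
Proof.
move=> b1 b2; rewrite /mean -lim_seriesD; [|exact: is_cvg_mean..].
by congr (limn (series _)); apply/funext => n; rewrite mulrDl.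
Qed.

Lemma meanZ c phi : bounded_nneg phi -> mean (fun n => c * phi n) = c * mean phi.
Proof.
move=> b1; rewrite /mean; have h := lim_seriesZ c (is_cvg_mean b1).
rewrite -[RHS]h; congr (limn (series _)); apply/funext => n.
by rewrite -mulrA.
Qed.

Lemma mean_cst c : mean (fun=> c) = c.
Proof.
transitivity (mean (fun n => c * 1)); first by congr mean; apply/funext => n; rewrite mulr1.
rewrite meanZ; last exact: bounded_nneg_cst.
rewrite /mean -[RHS]mulr1; congr (_ * _); apply/cvg_lim => //.
under eq_fun do rewrite mul1r; exact: cvg_series_mass.
Qed.

Lemma mean_eq0 : mean (fun n => (n == 0)%:R) = m 0.
Proof.
rewrite /mean; apply/cvg_lim => //; apply: cvg_near_cst; near=> n.
have n0 : (0 < n)%N by near: n; exact: nbhs_infty_gt.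
rewrite /series/= -(prednK n0) big_nat_recl//= mul1r big1 ?addr0// => i _.
by rewrite mul0r.
Unshelve. all: by end_near. Qed.

Lemma genfunE s : genfun mu s = mean (fun n => s ^+ n).
Proof. by []. Qed.

Lemma genfun0 : genfun mu 0 = m 0.
Proof.
rewrite -mean_eq0 genfunE; congr mean; apply/funext => n.
by rewrite expr0n.
Qed.

Lemma genfun1 : genfun mu 1 = 1.
Proof.
by rewrite -[RHS]mean_cst genfunE; congr mean; apply/funext => n; rewrite expr1n.
Qed.

Lemma le_genfun x y : 0 <= x -> x <= y -> y <= 1 -> genfun mu x <= genfun mu y.
Proof.
move=> x0 xy y1; apply: le_mean.
- by apply: bounded_nnegX; rewrite x0 (le_trans xy).
- by apply: bounded_nnegX; rewrite y1 (le_trans x0).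
- by move=> n; rewrite lerXn2r// nnegrE// (le_trans x0).
Qed.

Lemma mass0_le_genfun s : 0 <= s <= 1 -> m 0 <= genfun mu s.
Proof. by move=> /andP[s0 s1]; rewrite -genfun0; exact: le_genfun. Qed.

Lemma genfun_ge0 s : 0 <= s <= 1 -> 0 <= genfun mu s.
Proof. by move=> /mass0_le_genfun; apply: le_trans; exact: mass_ge0. Qed.

Lemma genfun_le1 s : 0 <= s <= 1 -> genfun mu s <= 1.
Proof. by move=> /andP[s0 s1]; rewrite -genfun1; exact: le_genfun. Qed.

(** Because s^n <= s for n >= 1. It keeps the iterates of f below 1 and forces positive mass at
    0. *)
Lemma genfun_le_affine s : 0 <= s <= 1 -> genfun mu s <= (1 - s) * m 0 + s.
Proof.
move=> /andP[s0 s1]; have s0' : 0 <= 1 - s by rewrite subr_ge0.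
rewrite -mean_eq0 -[leRHS]/(_ + s) -[X in _ + X]mean_cst -meanZ; last exact: bounded_nneg_eq0.
rewrite -meanD; last 2 first.
- by apply: bounded_nnegZ => //; exact: bounded_nneg_eq0.
- exact: bounded_nneg_cst.
apply: le_mean.
- by apply: bounded_nnegX; rewrite s0.
- apply: bounded_nnegD; last exact: bounded_nneg_cst.
  by apply: bounded_nnegZ => //; exact: bounded_nneg_eq0.
- case=> [|n]; first by rewrite mulr1 subrK.
  by rewrite mulr0 add0r exprS ler_piMr// exprn_ile1.
Qed.

Lemma exprn_convex n (t x y : R) : 0 <= t <= 1 -> 0 <= x -> 0 <= y ->
  (t * x + (1 - t) * y) ^+ n <= t * x ^+ n + (1 - t) * y ^+ n.
Proof.
move=> /andP[t0 t1] x0 y0; have t1' : 0 <= 1 - t by rewrite subr_ge0.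
elim: n => [|n IH]; first by rewrite !expr0 !mulr1 addrC subrK.
rewrite exprS; apply: (@le_trans _ _ ((t * x + (1 - t) * y) * (t * x ^+ n + (1 - t) * y ^+ n))).
  by rewrite ler_wpM2l// addr_ge0// mulr_ge0.
rewrite -subr_ge0 !exprS.
rewrite [leRHS](_ : _ = t * (1 - t) * ((x - y) * (x ^+ n - y ^+ n))); last by ring.
apply: mulr_ge0; first exact: mulr_ge0.
have [xy|yx] := lerP x y.
  by rewrite -mulrNN mulr_ge0// oppr_ge0 subr_le0// lerXn2r.
by rewrite mulr_ge0// subr_ge0 ?(ltW yx)// lerXn2r// ltW.
Qed.

Lemma genfun_convex (t x y : R) : 0 <= t <= 1 -> 0 <= x <= 1 -> 0 <= y <= 1 ->
  genfun mu (t * x + (1 - t) * y) <= t * genfun mu x + (1 - t) * genfun mu y.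
Proof.
move=> /andP[t0 t1] /andP[x0 x1] /andP[y0 y1].
have t1' : 0 <= 1 - t by rewrite subr_ge0.
have bx : bounded_nneg (fun n => x ^+ n) by apply: bounded_nnegX; rewrite x0.
have bY : bounded_nneg (fun n => y ^+ n) by apply: bounded_nnegX; rewrite y0.
rewrite !genfunE -!meanZ// -meanD; [|exact: bounded_nnegZ..].
apply: le_mean.
- apply: bounded_nnegX; rewrite addr_ge0 ?mulr_ge0//=.
  have : t * x <= t * 1 by rewrite ler_wpM2l.
  have : (1 - t) * y <= (1 - t) * 1 by rewrite ler_wpM2l.
  lra.
- by apply: bounded_nnegD; exact: bounded_nnegZ.
- by move=> n; apply: exprn_convex => //; rewrite t0.
Qed.

(** From y^n - x^n <= (y - x) (1 + y + ... + y^(n-1)) and the geometric series; it serves as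
    continuity of f on [0, 1). *)
Lemma genfun_lipschitz x y : 0 <= x -> x <= y -> y < 1 ->
  genfun mu y <= genfun mu x + (y - x) / (1 - y).
Proof.
move=> x0 xy y1; have y0 := le_trans x0 xy; have y1' : 0 < 1 - y by rewrite subr_gt0.
have c0 : 0 <= (y - x) / (1 - y) by rewrite divr_ge0 ?subr_ge0// ltW.
have bx : bounded_nneg (fun n => x ^+ n).
  by apply: bounded_nnegX; rewrite x0 (le_trans xy)// ltW.
rewrite -[leRHS]/(_ + (y - x) / (1 - y)) -[X in _ + X]mean_cst !genfunE.
rewrite -meanD//; last exact: bounded_nneg_cst.
apply: le_mean.
- by apply: bounded_nnegX; rewrite y0 ltW.
- by apply: bounded_nnegD => //; exact: bounded_nneg_cst.
- move=> n; rewrite -lerBlDl subrXX ler_wpM2l ?subr_ge0//.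
  rewrite -[leRHS]mul1r ler_pdivlMr//.
  apply: (@le_trans _ _ ((\sum_(i < n) y ^+ i) * (1 - y))).
    apply: ler_wpM2r; first exact: ltW.
    have -> : \sum_(i < n) y ^+ i = \sum_(i < n) y ^+ (n.-1 - i).
      rewrite (reindex_inj rev_ord_inj)/=; apply: eq_bigr => i _.
      by rewrite -subn1 -subnDA add1n.
    apply: ler_sum => i _; rewrite -[leRHS]mulr1.
    by apply: ler_pM; rewrite ?exprn_ge0// exprn_ile1// (le_trans xy)// ltW.
  rewrite mulrC -[X in X <= _]opprK -mulNr opprB -subrX1 opprB gerBl exprn_ge0//.
Qed.

End mean.

(** * Iterates of f at 0 under the stable assumption *)

Section stable_domain.
Context {R : realType} (mu nu : probability nat R) (c d alpha : R) (l k : R -> R).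
Implicit Types x y s : R.
Context (hnu : 0 < mass nu 0) (hSL : assumption_SL mu nu c d alpha l k).

Let f := genfun mu.
Let g := genfun nu.
Let psi (x : R) := f (1 - x) - (1 - x).
Let A (x : R) := psi x / x.
Let z n := iter n f 0.
Let q n := 1 - z n.

Let c0 : 0 < c. Proof. exact: SL_c_gt0 hSL. Qed.
Let d0 : 0 < d. Proof. exact: SL_d_gt0 hSL. Qed.
Let alpha0 : 0 < alpha. Proof. by case/andP: (SL_alpha hSL). Qed.
Let alpha1 : alpha <= 1. Proof. by case/andP: (SL_alpha hSL). Qed.

Let onem01 (x : R) : 0 < x < 1 -> 0 < 1 - x < 1.
Proof. by move=> /andP[x0 x1]; rewrite subr_gt0 x1 gtrBl. Qed.

Let psiE x : 0 < x < 1 -> psi x = c * x `^ (1 + alpha) * l x.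
Proof.
move=> x01; rewrite /psi /f (SL_offspring hSL) ?onem01//.
by rewrite subKr addrAC subrr add0r.
Qed.

Let AE x : 0 < x < 1 -> A x = c * x `^ alpha * l x.
Proof.
move=> x01; have /andP[x0 _] := x01; rewrite /A psiE// powRD; last first.
  by rewrite (gt_eqF x0) implybT.
by rewrite powRr1 ?ltW//; field; rewrite gt_eqF.
Qed.

Let psi_gt0 x : 0 < x < 1 -> 0 < psi x.
Proof.
move=> x01; have /andP[x0 _] := x01.
by rewrite psiE// !mulr_gt0 ?powR_gt0// (SL_l_gt0 hSL).
Qed.

Let A_gt0 x : 0 < x < 1 -> 0 < A x.
Proof. by move=> x01; have /andP[x0 _] := x01; rewrite divr_gt0// psi_gt0. Qed.

Let psi_convex (t x y : R) : 0 <= t <= 1 -> 0 <= x <= 1 -> 0 <= y <= 1 ->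
  psi (t * x + (1 - t) * y) <= t * psi x + (1 - t) * psi y.
Proof.
move=> t01 /andP[x0 x1] /andP[y0 y1].
have := @genfun_convex R mu t (1 - x) (1 - y) t01.
rewrite !subr_ge0 !gerBl x0 x1 y0 y1 => /(_ isT isT).
rewrite /psi /f (_ : t * (1 - x) + (1 - t) * (1 - y) = 1 - (t * x + (1 - t) * y)).
  by move: (genfun mu _) (genfun mu _) (genfun mu _) => a b e; lra.
by ring.
Qed.

Let psi0 : psi 0 = 0.
Proof. by rewrite /psi /f subr0 genfun1 subrr. Qed.

(* Convexity of psi with psi 0 = 0. This replaces Potter bounds for l. *)
Let A_nondecreasing x y : 0 < x -> x <= y -> y < 1 -> A x <= A y.
Proof.
move=> x0 xy y1; have y0 : 0 < y by apply: lt_le_trans xy.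
have xy01 : 0 <= x / y <= 1 by rewrite ler_pdivrMr// mul1r xy divr_ge0// ltW.
have := @psi_convex (x / y) y 0 xy01.
rewrite lexx ler01 psi0 !mulr0 !addr0 divfK ?gt_eqF// (ltW y0) (ltW y1).
move=> /(_ isT isT) h.
rewrite /A ler_pdivrMr//; apply: le_trans h _.
by rewrite le_eqVlt; apply/orP; left; apply/eqP; ring.
Qed.

Let A_ratio (t : R) : 0 < t -> (fun x => A (t * x) / A x) @ 0^'+ --> t `^ alpha.
Proof.
move=> t0; have H : (fun x => t `^ alpha * (l (t * x) / l x)) @ 0^'+ --> t `^ alpha * 1.
  by apply: cvgMl_tmp; exact: (SL_l_sv hSL t0).
rewrite mulr1 in H; apply: cvg_trans H; apply: near_eq_cvg; near=> x.
have x0 : 0 < x by near: x; exact: nbhs_right_gt.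
have x1 : x < 1 by near: x; exact: nbhs_right_lt.
have x1' : x < t^-1 by near: x; apply: nbhs_right_lt; rewrite invr_gt0.
have x01 : 0 < x < 1 by rewrite x0.
have tx01 : 0 < t * x < 1 by rewrite mulr_gt0//= -ltr_pdivlMl// mulr1.
rewrite !AE// powRM ?(ltW t0) ?(ltW x0)//.
have := SL_l_gt0 hSL x01; have : 0 < x `^ alpha by rewrite powR_gt0.
move: (x `^ alpha) (l x) => p lx p0 l0; field.
by rewrite !gt_eqF.
Unshelve. all: by end_near. Qed.

Let psi_ratio (t : R) : 0 < t -> (fun x => psi (t * x) / psi x) @ 0^'+ --> t `^ (1 + alpha).
Proof.
move=> t0; have H : (fun x => t * (A (t * x) / A x)) @ 0^'+ --> t * t `^ alpha.
  by apply: cvgMl_tmp; exact: A_ratio.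
rewrite powRD ?(gt_eqF t0) ?implybT// powRr1 ?(ltW t0)//.
apply: cvg_trans H; apply: near_eq_cvg; near=> x.
have x0 : 0 < x by near: x; exact: nbhs_right_gt.
have x1 : x < 1 by near: x; exact: nbhs_right_lt.
have x01 : 0 < x < 1 by rewrite x0.
by rewrite /A; field; rewrite !gt_eqF ?psi_gt0.
Unshelve. all: by end_near. Qed.

Let f_gt s : 0 < s < 1 -> s < f s.
Proof.
move=> s01; have := psi_gt0 (onem01 s01).
by rewrite /psi subKr subr_gt0.
Qed.

(** Otherwise the affine bound would read f(s) <= s, against [f_gt]. *)
Let m0_gt0 : 0 < mass mu 0.
Proof.
have h : 0 < (2^-1 : R) < 1 by apply/andP; split; lra.
rewrite lt_neqAle eq_sym mass_ge0 andbT; apply/eqP => m0.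
have := f_gt h; have := @genfun_le_affine R mu 2^-1.
rewrite m0 mulr0 add0r => /(_ _) h2.
have /andP[h3 h4] := h.
by rewrite ltNge h2// !ltW.
Qed.

(** With full mass at 0, A would be constantly 1, hence of index 0 and not alpha > 0. *)
Let m0_lt1 : mass mu 0 < 1.
Proof.
rewrite lt_neqAle; apply/andP; split; last first.
  by rewrite -(genfun0 mu) genfun_le1// lexx ler01.
apply/eqP => m0.
have A1 x : 0 < x < 1 -> A x = 1.
  move=> x01; have /andP[x0 x1] := x01; rewrite /A /psi.
  have s01 : 0 <= 1 - x <= 1 by have /andP[? ?] := onem01 x01; rewrite !ltW.
  have -> : f (1 - x) = 1.
    have := mass0_le_genfun mu s01; rewrite m0 => h.
    by apply/eqP; rewrite eq_le genfun_le1.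
  by rewrite subKr divff// gt_eqF.
have H := @A_ratio 2^-1 _.
have H1 : (fun x => A (2^-1 * x) / A x) @ 0^'+ --> (1 : R).
  apply: cvg_near_cst; near=> x.
  have x0 : 0 < x by near: x; exact: nbhs_right_gt.
  have x1 : x < 1 by near: x; exact: nbhs_right_lt.
  by rewrite !A1 ?divr1 ?x0//; apply/andP; split; lra.
have h20 : 0 < 2^-1 :> R by rewrite invr_gt0.
have E : 1 = 2^-1 `^ alpha :> R.
  exact: cvg_unique _ H1 (H h20).
have := @powR_eq1 R 2^-1 alpha; rewrite -E eqxx => /esym/or3P[/eqP e|e|/eqP e].
- by move: e; lra.
- by rewrite ltNge ltW in e.
- by move: alpha0; rewrite e ltxx.
Unshelve. all: by end_near. Qed.

Let z0 : z 0 = 0. Proof. by []. Qed.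
Let zS n : z n.+1 = f (z n). Proof. by []. Qed.

Let z_itv n : 0 <= z n < 1.
Proof.
elim: n => [|n /andP[z0' z1']]; first by rewrite lexx ltr01.
have z01 : 0 <= z n <= 1 by rewrite z0' ltW.
rewrite zS genfun_ge0//=; apply: le_lt_trans (genfun_le_affine mu z01) _.
rewrite -[ltRHS](subrK (z n)) ltrD2r -[ltRHS]mulr1 ltr_pM2l// subr_gt0//.
Qed.

Let zS_gt0 n : 0 < z n.+1.
Proof.
rewrite zS (lt_le_trans m0_gt0)// mass0_le_genfun//.
by have /andP[-> /ltW ->] := z_itv n.
Qed.

Let q_itv n : 0 < q n.+1 < 1.
Proof. by apply: onem01; rewrite zS_gt0; have /andP[] := z_itv n.+1. Qed.

Let z_inc n : z n.+1 <= z n.+2.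
Proof. by rewrite [leRHS]zS ltW// f_gt// zS_gt0; have /andP[] := z_itv n.+1. Qed.

(** A limit r < 1 would satisfy f(r) <= r, against [f_gt]. Monotonicity is used from index 1 on,
    since [f_gt] excludes z 0 = 0. *)
Let z_cvg : z @ \oo --> (1 : R).
Proof.
have hb : has_ubound (range (fun n => z n.+1)).
  by exists 1 => _ [n _ <-]; have /andP[_ /ltW] := z_itv n.+1.
have nd : nondecreasing_seq (fun n => z n.+1) by apply/nondecreasing_seqP.
have H := nondecreasing_cvgn nd hb.
set r := sup _ in H.
have zr n : z n.+1 <= r by apply: ub_le_sup => //; exists n.
have r0 : 0 < r by apply: lt_le_trans (zr 0); exact: zS_gt0.
have r1 : r <= 1.
  apply: ge_sup; first by exists (z 1), 0.
  by move=> _ [n _ <-]; have /andP[_ /ltW] := z_itv n.+1.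
suff rE : r = 1 by rewrite -cvg_shiftS -rE.
apply/eqP; rewrite eq_le r1/= leNgt; apply/negP => r1'.
have r01 : 0 < r < 1 by rewrite r0.
have : f r <= r.
  have H1 : (fun n => z n.+2 + (r - z n.+1) / (1 - r)) @ \oo --> r + (r - r) / (1 - r).
    apply: cvgD; first by have := H; rewrite -cvg_shiftS.
    by apply: cvgMr_tmp; apply: cvgB => //; exact: cvg_cst.
  rewrite subrr mul0r addr0 in H1.
  rewrite -[leRHS](cvg_lim (@Rhausdorff R) H1); apply: limr_ge; first exact: cvgP H1.
  apply: nearW => n; rewrite zS; apply: genfun_lipschitz => //.
  by rewrite ltW// zS_gt0.
by rewrite leNgt f_gt.
Qed.

(** The shift avoids q 0 = 1, outside the open interval on which the assumption speaks. *)
Let p n := q n.+1.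
Let e n := A (p n).

Let p_gt0 n : 0 < p n. Proof. by have /andP[] := q_itv n. Qed.

Let p_cvg : p @ \oo --> (0 : R).
Proof.
have h : q @ \oo --> (1 - 1 : R) by apply: cvgB; [exact: cvg_cst|exact: z_cvg].
by rewrite subrr -cvg_shiftS in h.
Qed.

Let cvg_along_p (F : R -> R) (a : R) : F @ 0^'+ --> a -> (F \o p) @ \oo --> a.
Proof. by move=> /cvg_at_rightP; apply; split. Qed.

Let e_gt0 n : 0 < e n. Proof. exact: A_gt0 (q_itv n). Qed.

Let pS n : p n.+1 = p n * (1 - e n).
Proof.
rewrite mulrBr mulr1 [_ * e n]mulrC /e /A divfK ?gt_eqF//.
by rewrite /psi /p /q subKr zS; ring.
Qed.

Let e_lt1 n : e n < 1.
Proof. by rewrite -subr_gt0 -(pmulr_rgt0 _ (p_gt0 n)) -pS. Qed.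

Let p_dec n : p n.+1 <= p n.
Proof. by rewrite pS ger_pMr// gerBl ltW. Qed.

Let e_dec n : e n.+1 <= e n.
Proof. by apply: A_nondecreasing => //; have /andP[] := q_itv n. Qed.

(** If e decreased to a > 0, then A (p n / 2) >= a for all n, since some p N lies below p n / 2.
    Thus A (p n / 2) / A (p n) >= a / e n --> 1, against the limit 2^(-alpha) < 1. *)
Let e_cvg : e @ \oo --> (0 : R).
Proof.
have hb : has_lbound (range e) by exists 0 => _ [n _ <-]; exact: ltW.
have nd : nonincreasing_seq e by apply/nonincreasing_seqP.
have H := nonincreasing_cvgn nd hb.
set a := inf _ in H.
have ae n : a <= e n by apply: ge_inf => //; exists n.
have a0 : 0 <= a by apply: lb_le_inf; [exists (e 0), 0|move=> _ [n _ <-]; exact: ltW].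
suff aE : a = 0 by rewrite -[X in _ --> X]aE.
apply/eqP; rewrite eq_le a0 andbT leNgt; apply/negP => a0'.
have h20 : 0 < 2^-1 :> R by lra.
have H1 := cvg_along_p (A_ratio h20).
have H2 : (fun n => a / e n) @ \oo --> a / a.
  by apply: cvgMl_tmp; apply: cvgV H; rewrite gt_eqF.
rewrite divff ?gt_eqF// in H2.
have : 1 <= 2^-1 `^ alpha :> R.
  rewrite -[leRHS](cvg_lim (@Rhausdorff R) H1) -[leLHS](cvg_lim (@Rhausdorff R) H2).
  apply: ler_lim; [exact: cvgP H2|exact: cvgP H1|].
  apply: nearW => n /=; rewrite -/(e n) ler_pM2r ?invr_gt0//.
  have pn2 : 0 < p n / 2 by rewrite divr_gt0.
  have [N _ HN] := cvgr_lt _ p_cvg _ pn2; have /= hN := HN N (leqnn N).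
  apply: le_trans (ae N) _; apply: A_nondecreasing => //.
    by rewrite mulrC ltW.
  by have /andP[_ h] := q_itv n; rewrite -/(p n) in h; have := p_gt0 n; lra.
apply/negP; rewrite -ltNge.
rewrite -[ltRHS](_ : (1 : R) `^ alpha = 1); last by rewrite powR1.
by apply: gt0_ltr_powR; rewrite ?nnegrE ?(ltW h20) ?ler01//; lra.
Unshelve. all: by end_near. Qed.

(** At t = 1 + h and t = 1 - h the right side is 1 + (1 + alpha) h + alpha h^2 and 1 - (1 + alpha) h
    + alpha h^2, so slopes are off by at most alpha h. *)
Let powR_succ_le t : 0 <= t -> t `^ (1 + alpha) <= t * (1 + alpha * (t - 1)).
Proof.
move=> t0; rewrite powRD; last first.
  by rewrite gt_eqF// addr_gt0.
rewrite powRr1// ler_wpM2l//.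
have [a1|] := eqVneq alpha 1; first by rewrite a1 powRr1//; lra.
by move=> a1; apply: powR_le_tangent => //; rewrite alpha0 lt_neqAle a1.
Qed.

(** The secant slope of psi over [p n.+1, p n], an interval of length e n * p n, relative to the
    slope A (p n) from the origin. *)
Let RR n := (psi (p n) - psi (p n.+1)) / (e n * psi (p n)).

Let psip n : 0 < psi (p n). Proof. exact: psi_gt0 (q_itv n). Qed.

(* The secant slope of the convex function psi over the shrinking interval
   [p n.+1, p n] lies between the slopes over [(1 - h) p n, p n] and
   [p n, (1 + h) p n], which are known by regular variation. *)
Let RR_cvg : RR @ \oo --> 1 + alpha.
Proof.
apply/cvgrPdistC_lt => eta eta0.
pose h := Num.min (1 / 2) (eta / 2).
have h0 : 0 < h by rewrite lt_min !divr_gt0.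
have h12 : h <= 1 / 2 by rewrite ge_min lexx.
have heta : h < eta.
  by apply: (@le_lt_trans _ _ (eta / 2)); [rewrite ge_min lexx orbT|lra].
have ah : alpha * h <= h by rewrite ger_pMl.
have hm : 0 < 1 - h by lra.
have hp : 0 < 1 + h by lra.
have Lm : (fun n => (1 - psi ((1 - h) * p n) / psi (p n)) / h) @ \oo -->
    (1 - (1 - h) `^ (1 + alpha)) / h.
  apply: cvgMr_tmp; apply: cvgB; first exact: cvg_cst.
  exact: (cvg_along_p (psi_ratio hm)).
have Lp : (fun n => (psi ((1 + h) * p n) / psi (p n) - 1) / h) @ \oo -->
    ((1 + h) `^ (1 + alpha) - 1) / h.
  apply: cvgMr_tmp; apply: cvgB; last exact: cvg_cst.
  exact: (cvg_along_p (psi_ratio hp)).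
have lm : 1 + alpha - eta < (1 - (1 - h) `^ (1 + alpha)) / h.
  rewrite ltr_pdivlMr//; have := powR_succ_le (ltW hm).
  have : h * (eta - alpha * h) > 0 by rewrite mulr_gt0// subr_gt0; lra.
  by move: (_ `^ _) => w; lra.
have lp : ((1 + h) `^ (1 + alpha) - 1) / h < 1 + alpha + eta.
  rewrite ltr_pdivrMr//; have := powR_succ_le (ltW hp).
  have : h * (eta - alpha * h) > 0 by rewrite mulr_gt0// subr_gt0; lra.
  by move: (_ `^ _) => w; lra.
near=> n.
have eh : e n < h by near: n; exact: (cvgr_lt _ e_cvg).
have ph : p n < 1 / 2 by near: n; apply: (cvgr_lt _ p_cvg); lra.
have e0 := e_gt0 n; have pn0 := p_gt0 n; have ps0 := psip n.
have pS' : p n.+1 = (1 - e n) * p n by rewrite pS mulrC.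
have lo : (1 - psi ((1 - h) * p n) / psi (p n)) / h <= RR n.
  (* Since e n < h, p n.+1 lies between (1 - h) p n and p n, with weight e n / h on the former. *)
  have eh1 : 0 <= e n / h <= 1 by rewrite ler_pdivrMr// mul1r (ltW eh) andbT divr_ge0// ltW.
  have := @psi_convex (e n / h) ((1 - h) * p n) (p n) eh1.
  rewrite (_ : e n / h * _ + _ = p n.+1); last by rewrite pS'; field; rewrite gt_eqF.
  have -> : 0 <= (1 - h) * p n <= 1.
    rewrite mulr_ge0 ?(ltW hm) ?(ltW pn0)//=.
    have : (1 - h) * p n <= 1 * p n by rewrite ler_wpM2r ?(ltW pn0)//; lra.
    lra.
  have -> : 0 <= p n <= 1 by apply/andP; split; lra.
  move=> /(_ isT isT); rewrite /RR.
  move: (psi ((1 - h) * p n)) (psi (p n)) (psi (p n.+1)) ps0 => a b w b0 hw.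
  rewrite [leLHS](_ : _ = (e n / h * (b - a)) / (e n * b)); last by field; rewrite !gt_eqF.
  have eb0 : 0 < (e n * b)^-1 by rewrite invr_gt0 mulr_gt0.
  rewrite (ler_pM2r eb0).
  by move: (e n / h) hw => y hw; lra.
have up : RR n <= (psi ((1 + h) * p n) / psi (p n) - 1) / h.
  have eh2 : 0 < e n + h by rewrite addr_gt0.
  have th1 : 0 <= e n / (e n + h) <= 1.
    by rewrite ler_pdivrMr// mul1r lerDl (ltW h0) andbT divr_ge0// ltW.
  (* Now p n is the interior point, between p n.+1 and (1 + h) p n. *)
  have := @psi_convex (e n / (e n + h)) ((1 + h) * p n) (p n.+1) th1.
  rewrite (_ : e n / (e n + h) * _ + _ = p n); last first.
    by rewrite pS'; field; rewrite gt_eqF.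
  have -> : 0 <= (1 + h) * p n <= 1.
    rewrite mulr_ge0 ?(ltW hp) ?(ltW pn0)//=.
    have : (1 + h) * p n <= (3 / 2) * p n by rewrite ler_wpM2r ?(ltW pn0)//; lra.
    lra.
  have -> : 0 <= p n.+1 <= 1.
    by have := p_dec n; have := p_gt0 n.+1; move=> ? ?; apply/andP; split; lra.
  move=> /(_ isT isT); rewrite /RR.
  move: (psi ((1 + h) * p n)) (psi (p n)) (psi (p n.+1)) ps0 => a b w b0 hw.
  have hw' : (e n + h) * b <= e n * a + h * w.
    rewrite -ler_pdivlMl//; apply: le_trans hw _.
    by rewrite le_eqVlt; apply/orP; left; apply/eqP; field; rewrite gt_eqF.
  rewrite [leRHS](_ : _ = (e n / h * (a - b)) / (e n * b)); last by field; rewrite !gt_eqF.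
  have eb0 : 0 < (e n * b)^-1 by rewrite invr_gt0 mulr_gt0.
  rewrite (ler_pM2r eb0) -(ler_pM2l h0).
  rewrite [leRHS](_ : _ = e n * (a - b)); last by field; rewrite gt_eqF.
  lra.
rewrite ltr_norml; apply/andP; split.
  rewrite ltrBrDl; apply: lt_le_trans lo.
  by near: n; apply: (cvgr_gt _ Lm).
rewrite ltrBlDl; apply: le_lt_trans up _.
by near: n; apply: (cvgr_lt _ Lp).
Unshelve. all: by end_near. Qed.

(** Exact, because p and psi p are multiplied by 1 - e n and 1 - RR n * e n. As RR --> 1 + alpha and
    e --> 0, the increments tend to alpha. *)
Let eV_step n : (e n.+1)^-1 - (e n)^-1 = (RR n - 1) / (1 - RR n * e n).
Proof.
have e0 := e_gt0 n; have pn0 := p_gt0 n; have ps0 := psip n.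
have ps1 := psip n.+1; have pn1 := p_gt0 n.+1.
have E : psi (p n.+1) = psi (p n) * (1 - RR n * e n).
  by rewrite /RR; field; rewrite !gt_eqF.
have r0 : 0 < 1 - RR n * e n by rewrite -(pmulr_rgt0 _ ps0) -E.
have e1 : 0 < 1 - e n by rewrite subr_gt0.
have -> : e n.+1 = e n * (1 - RR n * e n) / (1 - e n).
  have pe : psi (p n) = e n * p n by rewrite /e /A divfK// gt_eqF.
  rewrite -[LHS]/(psi (p n.+1) / p n.+1) E pS pe.
  by move: (RR n * e n) => w; field; rewrite !gt_eqF.
by field; rewrite !gt_eqF.
Qed.

Let ne_cvg : (fun n => n%:R * e n) @ \oo --> alpha^-1.
Proof.
have H : (fun n => (e n.+1)^-1 - (e n)^-1) @ \oo --> (1 + alpha - 1) / (1 - (1 + alpha) * 0).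
  under eq_cvg do rewrite eV_step.
  apply: cvgM; first by apply: cvgB; [exact: RR_cvg|exact: cvg_cst].
  apply: cvgV; first by rewrite mulr0 subr0 oner_neq0.
  by apply: cvgB; [exact: cvg_cst|apply: cvgM; [exact: RR_cvg|exact: e_cvg]].
rewrite mulr0 subr0 divr1 addrAC subrr add0r in H.
(* The Cesaro mean of the increments of 1 / e telescopes. *)
have K := cesaro H.
have K1 : (fun n => n.+1%:R^-1 * (e 0)^-1) @ \oo --> 0 * (e 0)^-1.
  by apply: cvgMr_tmp; exact: cvg_harmonic.
have K2 : (fun n => arithmetic_mean (fun n => (e n.+1)^-1 - (e n)^-1) n + n.+1%:R^-1 * (e 0)^-1)
    @ \oo --> alpha + 0 * (e 0)^-1 by exact: cvgD.
rewrite mul0r addr0 in K2.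
have K3 : (fun n => (n.+1%:R * e n.+1)^-1) @ \oo --> alpha.
  apply: cvg_trans K2; apply: near_eq_cvg; apply: nearW => n.
  rewrite /arithmetic_mean /series/= -mulrDr.
  have -> : \sum_(0 <= i < n.+1) ((e i.+1)^-1 - (e i)^-1) = (e n.+1)^-1 - (e 0)^-1.
    by rewrite telescope_sumr.
  by rewrite [RHS]invfM; congr (_ * _); exact: subrK.
rewrite -cvg_shiftS.
have K4 : (fun n => ((n.+1%:R * e n.+1)^-1)^-1) @ \oo --> alpha^-1.
  by apply: cvgV K3; rewrite gt_eqF.
by apply: cvg_trans K4; apply: near_eq_cvg; apply: nearW => n; rewrite invrK.
Qed.

Lemma prod_genfun_iter_gt0 n : 0 < \prod_(i < n) g (z i).
Proof.
apply: prodr_gt0 => i _; apply: lt_le_trans hnu _.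
by apply: mass0_le_genfun; have /andP[-> /ltW ->] := z_itv i.
Qed.

(** The ratio of consecutive products is g (z n), and with p = p n both 1 - g (z n.+1) = d p^alpha
    k(p) and e n = c p^alpha l(p); the quotient tends to d / c. *)
Lemma prod_genfun_iter_ratio :
  (fun n => n%:R * (1 - (\prod_(i < n.+1) g (z i)) / (\prod_(i < n) g (z i))))
    @ \oo --> d / (alpha * c).
Proof.
have kl : (fun x => (l x / k x)^-1) @ 0^'+ --> (1 : R).
  by rewrite -[X in _ --> X]invr1; apply: cvgV; [exact: oner_neq0|exact: (SL_lk hSL)].
have H : (fun n => (n%:R * e n + e n) * (d / c) * (l (p n) / k (p n))^-1) @ \oo -->
    (alpha^-1 + 0) * (d / c) * 1.
  apply: cvgM; last exact: (cvg_along_p kl).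
  by apply: cvgMr_tmp; apply: cvgD; [exact: ne_cvg|exact: e_cvg].
rewrite addr0 mulr1 (_ : alpha^-1 * (d / c) = d / (alpha * c)) in H; last first.
  by field; rewrite !gt_eqF.
rewrite -cvg_shiftS; apply: cvg_trans H; apply: near_eq_cvg; apply: nearW => n /=.
have h := prod_genfun_iter_gt0 n.+1.
have -> : (\prod_(i < n.+2) g (z i)) / (\prod_(i < n.+1) g (z i)) = g (z n.+1).
  by rewrite big_ord_recr/= mulrAC divff ?gt_eqF// mul1r.
have z01 : 0 < z n.+1 < 1 by rewrite zS_gt0; have /andP[] := z_itv n.+1.
rewrite /g (SL_immigration hSL z01) -/(q n.+1) -/(p n) subKr.
have e0 : e n = c * p n `^ alpha * l (p n) by apply: AE; exact: q_itv.
rewrite e0 -natr1.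
have := SL_l_gt0 hSL (q_itv n); have := SL_k_gt0 hSL (q_itv n).
rewrite -/(p n); move: (l (p n)) (k (p n)) (p n `^ alpha) => a b w b0 a0.
by field; rewrite !gt_eqF.
Qed.

End stable_domain.
(** * The return times of the chain to 0 *)

Section conv_series.
Context {R : realType}.
Implicit Types (p q : nat -> R) (s : R).

Lemma nneseries_fin n (F : nat -> \bar R) : (forall i, 0%E <= F i)%E ->
  (forall i, (n <= i)%N -> F i = 0%E) ->
  (\sum_(0 <= i <oo) F i = \sum_(0 <= i < n) F i)%E.
Proof.
move=> F0 Fn; rewrite (@nneseries_split _ _ 0 n)// add0n.
by rewrite [X in (_ + X)%E]eseries0 ?adde0// => i ni _; exact: Fn.
Qed.

(** The Cauchy product by Tonelli: [a] is the triangular array of products, summed first by columns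
    and then by rows. *)
Lemma nneseries_conv p q s (b : R) : (forall i, 0 <= p i) -> (forall i, 0 <= q i) ->
  0 <= s -> (\sum_(0 <= j <oo) (q j * s ^+ j)%:E = b%:E)%E ->
  (\sum_(0 <= j <oo) (Defs.conv p q j * s ^+ j)%:E =
   b%:E * \sum_(0 <= i <oo) (p i * s ^+ i)%:E)%E.
Proof.
move=> p0 q0 s0 qb.
pose a i j : \bar R := if (i <= j)%N then (p i * s ^+ i * (q (j - i)%N * s ^+ (j - i)))%:E else 0%E.
have a0 i j : (0 <= a i j)%E.
  by rewrite /a; case: ifP => // _; rewrite lee_fin !mulr_ge0// exprn_ge0.
transitivity (\sum_(0 <= j <oo) \sum_(0 <= i <oo) a i j)%E.
  apply: eq_eseriesr => j _; rewrite (@nneseries_fin j.+1)//; last first.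
    by move=> i ji; rewrite /a leqNgt ji.
  rewrite /Defs.conv mulr_suml -sumEFin big_mkord; apply: eq_bigr => i _.
  have ij : (i <= j)%N by rewrite -ltnS.
  rewrite /a ij; congr EFin.
  have -> : s ^+ j = s ^+ i * s ^+ (j - i) by rewrite -exprD subnKC.
  ring.
rewrite nneseries_interchange//.
have s0' i : 0 <= s ^+ i by rewrite exprn_ge0.
rewrite -nneseriesZl; last by move=> i _; rewrite lee_fin mulr_ge0.
apply: eq_eseriesr => i _.
rewrite (@nneseries_split _ _ 0 i)// add0n big_nat big1 ?add0e; last first.
  by move=> j /andP[_ ji]; rewrite /a leqNgt ji.
rewrite -nneseries_addn//.
transitivity (\sum_(0 <= j <oo) (p i * s ^+ i)%:E * (q j * s ^+ j)%:E)%E.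
  by apply: eq_eseriesr => j _; rewrite /a leq_addl addnK EFinM.
rewrite nneseriesZl; last by move=> j _; rewrite lee_fin mulr_ge0.
by rewrite qb muleC.
Qed.

Lemma nneseries_genfun (mu : probability nat R) s : 0 <= s <= 1 ->
  (\sum_(0 <= j <oo) (mass mu j * s ^+ j)%:E = (genfun mu s)%:E)%E.
Proof.
move=> s01; have h := @is_cvg_mean R mu _ (bounded_nnegX s01).
rewrite /genfun -(EFin_lim h); congr (limn _); apply/funext => n /=.
by rewrite /series/= -sumEFin; apply: eq_bigr => i _; rewrite mulrC.
Qed.

Lemma bgwi_trans_ge0 (mu nu : probability nat R) i j : 0 <= bgwi_trans mu nu i j.
Proof.
rewrite /bgwi_trans; elim: i j => [|i IH] j /=; first exact: mass_ge0.
by apply: sumr_ge0 => k _; rewrite mulr_ge0// mass_ge0.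
Qed.

Lemma nneseries_bgwi_trans (mu nu : probability nat R) s i : 0 <= s <= 1 ->
  (\sum_(0 <= j <oo) (bgwi_trans mu nu i j * s ^+ j)%:E =
   (genfun nu s * genfun mu s ^+ i)%:E)%E.
Proof.
move=> s01; have /andP[s0 _] := s01; elim: i => [|i IH].
  by rewrite nneseries_genfun// mulr1.
rewrite (@nneseries_conv (mass mu) (bgwi_trans mu nu i) s _ _ _ _ IH)//.
- by rewrite nneseries_genfun// -EFinM exprSr mulrA.
- by move=> k; exact: mass_ge0.
- by move=> k; exact: bgwi_trans_ge0.
Qed.

End conv_series.

(** * Markov property, return probabilities and renewal equation of the chain *)

Section bgwi_chain.
Context {R : realType} (disp : measure_display) (T : measurableType disp)
  (P : probability T R) (mu nu : probability nat R) (Z : nat -> T -> nat).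
Context (hZ : is_BGWI P mu nu Z).
Implicit Types (E : set (nat -> nat)) (n i y r : nat).

Local Notation path x := (fun i => Z i x).

(** [E] is decided by the history up to time n. There are countably many histories, so this alone
    yields measurability. *)
Let dep n E := forall z z', (forall i, (i <= n)%N -> z i = z' i) -> E z -> E z'.

(* Histories are coded by integers so that events split into countably many
   cylinders, on which the law of the chain is given by BGWI_step. *)
Let hist n x : nat := pickle (mkseq (path x) n.+1).

Let histP n x x' : hist n x = hist n x' <-> forall i, (i <= n)%N -> Z i x = Z i x'.
Proof.
split.
  move=> /(pcan_inj pickleK) h i ni.
  by rewrite -(@nth_mkseq _ 0 (path x) n.+1)// h nth_mkseq.
move=> h; congr pickle; apply: (@eq_from_nth _ 0); rewrite !size_mkseq// => i ni.
by rewrite !nth_mkseq// h.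
Qed.

Let cyl n (z : nat -> nat) := [set x | forall i, (i <= n)%N -> Z i x = z i].

Let measurable_Z n (B : set nat) : measurable [set x | B (Z n x)].
Proof.
have := BGWI_meas hZ n; move=> /(_ measurableT B); rewrite setTI; apply.
by [].
Qed.

Let measurable_cyl n z : measurable (cyl n z).
Proof.
have -> : cyl n z = \bigcap_(i in [set i | (i <= n)%N]) [set x | [set z i] (Z i x)].
  by apply/seteqP; split.
apply: bigcap_measurable => [|i _]; first by exists 0.
exact: measurable_Z.
Qed.

Let fiberP n E h : dep n E ->
  [set x | E (path x) /\ hist n x = h] = set0 \/
  exists2 x0, E (path x0) & [set x | E (path x) /\ hist n x = h] = cyl n (path x0).
Proof.
move=> dE; have [[x0 [Ex0 hx0]]|no] := pselect (exists x, E (path x) /\ hist n x = h).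
  right; exists x0 => //; apply/seteqP; split => x /=.
    by move=> [_ hx]; apply/histP; rewrite hx.
  move=> hx; split; last by rewrite -hx0; apply/histP.
  by apply: dE Ex0 => i ni; rewrite hx.
by left; apply/seteqP; split => // x hx; case: no; exists x.
Qed.

Let partition_hist n E :
  [set x | E (path x)] = \bigcup_h [set x | E (path x) /\ hist n x = h].
Proof.
by apply/seteqP; split => [x Ex|x [h _ []]//]; exists (hist n x).
Qed.

Lemma measurable_dep n E : dep n E -> measurable [set x | E (path x)].
Proof.
move=> dE; rewrite (partition_hist n); apply: bigcup_measurable => h _.
by have [->|[x0 _ ->]] := fiberP h dE.
Qed.

Let countable_additivity (A : set T) (X : T -> nat) :
  (forall h, measurable [set x | A x /\ X x = h]) ->
  P A = (\sum_(0 <= h <oo) P [set x | A x /\ X x = h])%E.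
Proof.
move=> mA; rewrite -measure_semi_bigcup//.
- by congr (P _); apply/seteqP; split => [x Ax|x [h _ []]//]; exists (X x).
- by move=> h h' _ _ [x [[_ <-] [_ <-]]].
- exact: bigcup_measurable.
Qed.

Lemma markov_step n E i y : dep n E -> (forall z, E z -> z n = i) ->
  P [set x | E (path x) /\ Z n.+1 x = y] =
  (P [set x | E (path x)] * (bgwi_trans mu nu i y)%:E)%E.
Proof.
move=> dE En.
have mEh h : measurable [set x | E (path x) /\ hist n x = h].
  by have [->|[x0 _ ->]] := fiberP h dE.
rewrite (@countable_additivity _ (hist n)); last first.
  move=> h; rewrite (_ : [set x | _] = [set x | E (path x) /\ hist n x = h] `&`
    [set x | [set y] (Z n.+1 x)]); first exact: measurableI.
  by apply/seteqP; split => x /= [[? ?] ?].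
rewrite [in RHS](@countable_additivity _ (hist n))// muleC -nneseriesZl//.
apply: eq_eseriesr => h _.
have [E0|[x0 Ex0 Eh]] := fiberP h dE.
  rewrite E0 (_ : [set x | _] = set0) ?measure0 ?mule0//.
  apply/seteqP; split => // x /= [[Ex _] hx].
  by have : set0 x by rewrite -E0.
rewrite Eh.
(* The trajectory of the representative x0 up to time n, continued by y. *)
pose z j := if j == n.+1 then y else Z j x0.
have := BGWI_step hZ n z.
rewrite (_ : [set x | _] = [set x | (E (path x) /\ Z n.+1 x = y) /\ hist n x = h]).
  rewrite (_ : [set x | forall j, (j <= n)%N -> _] = cyl n (path x0)).
    rewrite /z ltn_eqF// eqxx (En _ Ex0) => H.
    rewrite -[LHS]fineK ?fin_num_measure//; last first.
      rewrite (_ : [set x | _] = [set x | E (path x) /\ hist n x = h] `&`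
        [set x | [set y] (Z n.+1 x)]); first exact: measurableI.
      by apply/seteqP; split => x /= [[? ?] ?].
    by rewrite H EFinM fineK ?fin_num_measure// muleC.
  apply/seteqP; split => x /= hx j jn; have := hx j jn; rewrite /z ltn_eqF//.
apply/seteqP; split => x /=.
  move=> hx; have cx : cyl n (path x0) x.
    by move=> j jn; have := hx j (leqW jn); rewrite /z ltn_eqF.
  have [Ex ?] : [set x | E (path x) /\ hist n x = h] x by rewrite Eh.
  by split => //; split => //; have := hx n.+1 (leqnn _); rewrite /z eqxx.
move=> [[Ex Zx] hx] j; rewrite leq_eqVlt => /predU1P[->|]; first by rewrite /z eqxx.
rewrite ltnS => jn; rewrite /z ltn_eqF//.
have : [set x | E (path x) /\ hist n x = h] x by [].
by rewrite Eh; apply.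
Qed.

Lemma bgwi_gen_step n s : 0 <= s <= 1 ->
  (\sum_(0 <= j <oo) P [set x | Z n.+1 x = j] * (s ^+ j)%:E =
   (genfun nu s)%:E * \sum_(0 <= i <oo) P [set x | Z n x = i] * (genfun mu s ^+ i)%:E)%E.
Proof.
move=> s01; have /andP[s0 _] := s01.
have f0 := genfun_ge0 mu s01; have g0 := genfun_ge0 nu s01.
have mZ k i : measurable [set x | Z k x = i] by exact: (@measurable_Z k [set i]).
have depZ i : dep n (fun z => z n = i) by move=> z z' h <-; rewrite h.
have step j : P [set x | Z n.+1 x = j] =
    (\sum_(0 <= i <oo) P [set x | Z n x = i] * (bgwi_trans mu nu i j)%:E)%E.
  rewrite (@countable_additivity _ (Z n)); last first.
    move=> i; rewrite (_ : [set x | _] = [set x | Z n.+1 x = j] `&` [set x | Z n x = i]).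
      exact: measurableI.
    by apply/seteqP; split.
  apply: eq_eseriesr => i _.
  rewrite -(@markov_step n (fun z => z n = i) i j (depZ i))//.
  by congr (P _); apply/seteqP; split => x /= [].
have s0' j : 0 <= s ^+ j by rewrite exprn_ge0.
transitivity (\sum_(0 <= j <oo) \sum_(0 <= i <oo)
    P [set x | Z n x = i] * (bgwi_trans mu nu i j * s ^+ j)%:E)%E.
  apply: eq_eseriesr => j _; rewrite step muleC -nneseriesZl; last first.
    by move=> i _; rewrite mule_ge0// lee_fin bgwi_trans_ge0.
  by apply: eq_eseriesr => i _; rewrite muleCA -EFinM [s ^+ j * _]mulrC.
rewrite nneseries_interchange; last first.
  by move=> i j; rewrite mule_ge0// lee_fin mulr_ge0// bgwi_trans_ge0.
rewrite -nneseriesZl; last by move=> i _; rewrite mule_ge0// lee_fin exprn_ge0.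
apply: eq_eseriesr => i _.
rewrite muleCA -EFinM -(nneseries_bgwi_trans mu nu i s01).
rewrite -[P _]fineK ?fin_num_measure// nneseriesZl//.
by move=> j _; rewrite lee_fin mulr_ge0// bgwi_trans_ge0.
Qed.

(** The induction must be uniform in s: each time step contributes a factor g(s) and replaces s by
    f(s). *)
Lemma bgwi_genfun n s : 0 <= s <= 1 ->
  (\sum_(0 <= j <oo) P [set x | Z n x = j] * (s ^+ j)%:E =
   (\prod_(i < n) genfun nu (iter i (genfun mu) s))%:E)%E.
Proof.
elim: n s => [|n IH] s s01; last first.
  rewrite bgwi_gen_step// IH; last by rewrite genfun_ge0// genfun_le1.
  rewrite big_ord_recl -EFinM; congr (_ * _)%:E.
  by apply: eq_bigr => i _; rewrite -iterSr.
have /andP[s0 _] := s01.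
rewrite big_ord0 (@nneseries_fin _ 1); last 2 first.
- by move=> i; rewrite mule_ge0// lee_fin exprn_ge0.
- move=> i i1; have -> : P [set x | Z 0 x = i] = 0%E; last by rewrite mul0e.
  have mZ j : measurable [set x | Z 0 x = j] by exact: (@measurable_Z 0 [set j]).
  apply/eqP; rewrite eq_le measure_ge0 andbT.
  apply: (@le_trans _ _ (P (~` [set x | Z 0 x = 0]))).
    apply: le_measure; rewrite ?inE//; first exact: measurableC.
    by move=> x /= ->; move: i1; case: (i).
  by rewrite probability_setC// (BGWI_init hZ) subee.
by rewrite big_nat1 expr0 mule1 (BGWI_init hZ).
Qed.

Lemma bgwi_return n : P [set x | Z n x = 0] =
  (\prod_(i < n) genfun nu (iter i (genfun mu) 0))%:E.
Proof.
rewrite -bgwi_genfun ?lexx ?ler01// (@nneseries_fin _ 1); last 2 first.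
- by move=> i; rewrite mule_ge0// lee_fin exprn_ge0.
- by move=> i i1; rewrite expr0n gtn_eqF// mule0.
by rewrite big_nat1 expr0 mule1.
Qed.

(* avoid r i is the probability of not hitting 0 at times 1, ..., r from i. *)
Definition avoid r : nat -> \bar R := iter r
  (fun h i => \sum_(0 <= y <oo) if y == 0%N then 0 else (bgwi_trans mu nu i y)%:E * h y)%E
  (fun=> 1%E).

Lemma avoid_ge0 r i : (0 <= avoid r i)%E.
Proof.
elim: r i => [|r IH] i; first exact: lee01.
apply: nneseries_ge0 => y _ _; case: ifP => // _.
by rewrite mule_ge0// lee_fin bgwi_trans_ge0.
Qed.

(** Induction on r: the event Z n.+1 = y is absorbed into [E], which again fixes the current
    state. *)
Lemma markov_avoid r n E i : dep n E -> (forall z, E z -> z n = i) ->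
  P [set x | E (path x) /\ forall j, (n < j <= n + r)%N -> Z j x <> 0] =
  (P [set x | E (path x)] * avoid r i)%E.
Proof.
elim: r n E i => [|r IH] n E i dE En.
  rewrite mule1; congr (P _); apply/seteqP; split => x /=; first by case.
  move=> Ex; split => // j; rewrite addn0 => /andP[nj jn].
  by move: nj; rewrite ltnNge jn.
have dE' y : dep n.+1 (fun z => E z /\ z n.+1 = y).
  move=> z z' h [Ez <-]; split; last by rewrite h.
  by apply: dE Ez => j jn; rewrite h// leqW.
have dE'' : dep (n + r.+1) (fun z => E z /\ forall j, (n < j <= n + r.+1)%N -> z j <> 0).
  move=> z z' h [Ez hz]; split.
    by apply: dE Ez => j jn; rewrite h// (leq_trans jn)// leq_addr.
  by move=> j jn; have /andP[_ jr] := jn; rewrite -(h j jr); exact: hz.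
rewrite (@countable_additivity _ (Z n.+1)); last first.
  move=> y; rewrite (_ : [set x | _] = [set x | E (path x) /\
      forall j, (n < j <= n + r.+1)%N -> Z j x <> 0] `&` [set x | [set y] (Z n.+1 x)]).
    exact: measurableI (measurable_dep dE'') (measurable_Z _ _).
  by apply/seteqP; split.
rewrite -[P [set x | E (path x)]]fineK ?fin_num_measure//; last exact: measurable_dep dE.
rewrite [avoid r.+1 i]/= -nneseriesZl; last first.
  move=> y _; case: ifP => // _; rewrite mule_ge0 ?avoid_ge0// lee_fin bgwi_trans_ge0.
  by [].
apply: eq_eseriesr => y _; rewrite fineK ?fin_num_measure//; last exact: measurable_dep dE.
case: eqP => [->|y0].
  rewrite mule0 (_ : [set x | _] = set0) ?measure0//.
  apply/seteqP; split => // x /= [[_ h] Zx].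
  by apply: (h n.+1); rewrite ?ltnSn ?addnS ?ltnS ?leq_addr.
rewrite muleA -(markov_step y dE En) -(IH _ _ _ (dE' y))//; last by move=> z [].
congr (P _); apply/seteqP; split => x /=.
  move=> [[Ex h] Zx]; split => // j; rewrite addSnnS => /andP[nj jn].
  by apply: h; rewrite jn (ltnW nj).
move=> [[Ex Zx] h]; split => //; split => // j /andP[nj jn].
have [jE|jn1] := eqVneq j n.+1; first by rewrite jE Zx.
by apply: h; rewrite addSnnS jn ltn_neqAle eq_sym jn1 nj.
Qed.

(** Keeping Z 0 = 0 in the event makes it the excursion event of [bgwi_excursion] for n = 0. *)
Definition escape r := fine (P [set x | Z 0 x = 0 /\
  forall j, (0 < j <= r)%N -> Z j x <> 0]).

Let dep0 n : dep n (fun z => z n = 0).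
Proof. by move=> z z' h <-; rewrite h. Qed.

Let measurable_excursion n r : measurable [set x | Z n x = 0 /\
  forall j, (n < j <= n + r)%N -> Z j x <> 0].
Proof.
apply: (@measurable_dep (n + r) (fun z => z n = 0 /\
   forall j, (n < j <= n + r)%N -> z j <> 0)).
move=> z z' h [zn hz]; split; first by rewrite -h// leq_addr.
by move=> j jn; have /andP[_ jr] := jn; rewrite -(h j jr); exact: hz.
Qed.

Lemma escapeE r : avoid r 0 = (escape r)%:E.
Proof.
rewrite /escape fineK ?fin_num_measure//; last exact: (@measurable_excursion 0 r).
by rewrite (@markov_avoid r 0 (fun z => z 0%N = 0%N) 0 (@dep0 0))// (BGWI_init hZ) mul1e.
Qed.

Lemma escape_ge0 r : 0 <= escape r.
Proof. by rewrite fine_ge0. Qed.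

Lemma escape_dec r r' : (r <= r')%N -> escape r' <= escape r.
Proof.
move=> rr'; rewrite /escape fine_le ?fin_num_measure//; try exact: (@measurable_excursion 0).
apply: le_measure; rewrite ?inE//; try exact: (@measurable_excursion 0).
move=> x /= [Z0 h]; split => // j /andP[j0 jr]; apply: h.
by rewrite j0 (leq_trans jr).
Qed.

Lemma bgwi_excursion n r :
  fine (P [set x | Z n x = 0 /\ forall j, (n < j <= n + r)%N -> Z j x <> 0]) =
  (\prod_(i < n) genfun nu (iter i (genfun mu) 0)) * escape r.
Proof.
by rewrite (@markov_avoid r n (fun z => z n = 0) 0 (@dep0 n))// escapeE bgwi_return.
Qed.

(** The events [B m] that m is the last zero up to n are disjoint and cover the event Z 0 = 0, of
    probability 1. *)
Lemma bgwi_renewal n : Defs.conv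
  (fun m => \prod_(i < m) genfun nu (iter i (genfun mu) 0)) escape n = 1.
Proof.
rewrite /Defs.conv; pose B (m : nat) := [set x | Z m x = 0 /\
  forall j, (m < j <= m + (n - m))%N -> Z j x <> 0].
under eq_bigr do rewrite -bgwi_excursion.
have mB m : measurable (B m) by exact: measurable_excursion.
apply: EFin_inj; rewrite -sumEFin.
under eq_bigr do rewrite fineK ?fin_num_measure//.
have mU : measurable (\big[setU/set0]_(i < n.+1) B i) by exact: bigsetU_measurable.
transitivity (P (\big[setU/set0]_(i < n.+1) B i)).
  rewrite (@measure_semi_additive_ord _ _ _ P n.+1 (fun i : 'I_n.+1 => B i))//.
  move=> i i' _ _ [x [[Zi hi] [Zi' hi']]]; apply: ord_inj.
  have iE (i0 : 'I_n.+1) : (i0 + (n - i0) = n)%N by rewrite subnKC// -ltnS.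
  case: (ltngtP (nat_of_ord i) (nat_of_ord i')) => // ii'; exfalso.
    by apply: (hi i' _ Zi'); rewrite ii' iE /= -ltnS ltn_ord.
  by apply: (hi' i _ Zi); rewrite ii' iE /= -ltnS ltn_ord.
apply/eqP; rewrite eq_le; apply/andP; split; first exact: probability_le1.
rewrite -(BGWI_init hZ); apply: le_measure; rewrite ?inE//.
  exact: (@measurable_Z 0 [set 0]).
move=> x /= Z0; rewrite -(bigcup_mkord n.+1 B).
have [m mn hm] : exists2 m, (m <= n)%N & Z m x = 0 /\ forall j, (m < j <= n)%N -> Z j x <> 0.
  elim: n {B mB mU} => [|k [m mk [Zm hm]]].
    by exists 0 => //; split => // j /andP[j0]; rewrite leqNgt j0.
  have [Zk|/eqP Zk] := eqVneq (Z k.+1 x) 0.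
    by exists k.+1 => //; split => // j /andP[j0]; rewrite leqNgt j0.
  exists m; first exact: leqW.
  split => // j /andP[mj]; rewrite leq_eqVlt => /predU1P[->//|jk].
  by apply: hm; rewrite mj.
by exists m; rewrite //= /B /= subnKC.
Qed.

End bgwi_chain.
(** * The last zero as a measurable functional of the path *)

Section last_zero.
Context {R : realType}.
Implicit Types (w : R -> R) (t s r : R).

Let has_zero t r w := exists2 u, r < u <= t & w u = 0.

(** The supremum need not be attained, hence the clause for every r < s. As s > 0, the value 0 of
    [sup] on the empty set cannot interfere. *)
Lemma last_zeroP t s w : 0 < s < t -> last_zero t w = s <->
  ~ has_zero t s w /\ forall r, 0 <= r < s -> has_zero t r w.
Proof.
move=> /andP[s0 st]; pose S := [set u | 0 <= u <= t /\ w u = 0].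
have ubS : has_ubound S by exists t => u [/andP[]].
rewrite /last_zero -/S; split=> [Ss|[h1 h2]].
  have S0 : S !=set0.
    apply/set0P; apply/eqP => S0; move: Ss; rewrite S0 sup0 => E.
    by rewrite -E ltxx in s0.
  split=> [[u /andP[su ut] wu]|r /andP[r0 rs]].
    have : u <= s by rewrite -Ss; apply: ub_le_sup => //; split => //; rewrite ut andbT (le_trans _ (ltW su))// ltW.
    by rewrite leNgt su.
  rewrite -Ss in rs; have [u [/andP[u0 ut] wu] ru] := sup_gt S0 rs.
  by exists u => //; rewrite ru.
have S0 : S !=set0.
  have [u /andP[u0 ut] wu] := h2 0 (introT andP (conj (lexx _) s0)).
  by exists u; split => //; rewrite (ltW u0).
apply/eqP; rewrite eq_le; apply/andP; split.
  apply: ge_sup => // u [/andP[u0 ut] wu]; rewrite leNgt; apply/negP => su.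
  by apply: h1; exists u => //; rewrite su.
rewrite leNgt; apply/negP => Ss.
have sup0' : 0 <= sup S.
  have [u Su] := S0; have [/andP[u0 _] _] := Su.
  by apply: le_trans u0 _; exact: ub_le_sup.
have [u /andP[u0 ut] wu] := h2 (sup S) (introT andP (conj sup0' Ss)).
have : u <= sup S by apply: ub_le_sup => //; split => //; rewrite ut (le_trans sup0')// ltW.
by rewrite leNgt u0.
Qed.

Definition right_step w := forall s, 0 <= s -> \forall u \near s^'+, w u = w s.

(* For a right-step path, zeros in an interval are detected at rational times
   and at the right endpoint, so countably many coordinates suffice. *)
Let has_rat_zero t r w := w t = 0 \/ exists q : rat, r < ratr q < t /\ w (ratr q) = 0.

Let has_zero_rat t r w : right_step w -> 0 <= r < t ->
  has_zero t r w <-> has_rat_zero t r w.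
Proof.
move=> hw /andP[r0 rt]; split.
  move=> [u /andP[ru]]; rewrite le_eqVlt => /predU1P[-> wt|ut wu]; first by left.
  right; have u0 : 0 <= u by rewrite (le_trans r0)// ltW.
  have [e /= e0 He] := hw u u0.
  have lt1 : u < Num.min t (u + e) by rewrite lt_min ut ltrDl.
  have [q] := rat_in_itvoo lt1; rewrite in_itv/= => /andP[uq].
  rewrite lt_min => /andP[qt que]; exists q; rewrite qt (lt_trans ru)//.
  split => //; rewrite He//=.
  by rewrite distrC gtr0_norm ?subr_gt0// ltrBlDl.
by move=> [wt|[q [/andP[rq qt] wq]]]; [exists t; rewrite ?rt ?lexx|exists (ratr q) => //; rewrite rq ltW].
Qed.

(** The levels s k / (k + 1) increase to s and replace the uncountably many r < s. *)
Definition last_zero_event t s : set (R -> R) :=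
  [set w | ~ has_rat_zero t s w] `&`
  \bigcap_k [set w | has_rat_zero t (s * (k%:R / k.+1%:R)) w].

Lemma last_zero_eventP t s w : 0 < s < t -> right_step w ->
  last_zero t w = s <-> last_zero_event t s w.
Proof.
move=> st hw; have /andP[s0 st'] := st; rewrite last_zeroP//.
have rk k : 0 <= s * (k%:R / k.+1%:R) < s.
  rewrite mulr_ge0 ?(ltW s0)//= -[ltRHS]mulr1 ltr_pM2l// ltr_pdivrMr// mul1r.
  by rewrite ltr_nat.
have rkt k : 0 <= s * (k%:R / k.+1%:R) < t.
  by have /andP[-> h] := rk k; rewrite (lt_trans h).
have s0t : 0 <= s < t by rewrite (ltW s0).
have HZ r : 0 <= r < t -> has_zero t r w <-> has_rat_zero t r w by exact: has_zero_rat.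
split=> [[h1 h2]|[/= h1 h2]].
  split; first by move=> /(HZ _ s0t).
  by move=> k _; apply/(HZ _ (rkt k)); exact: h2.
split; first by move=> /(HZ _ s0t).
move=> r /andP[r0 rs].
have d0 : 0 < s - r by rewrite subr_gt0.
(* The inequality s / (s - r) < k + 1 is equivalent to r < s k / (k + 1). *)
pose k := Num.truncn (s / (s - r)).
have hk : s / (s - r) < k.+1%:R by exact: truncnS_gt.
have rk' : r < s * (k%:R / k.+1%:R).
  rewrite mulrA ltr_pdivlMr//; move: hk; rewrite ltr_pdivrMr// -natr1; lra.
have [u /andP[u1 u2] wu] := (HZ _ (rkt k)).2 (h2 k I).
by exists u => //; rewrite (lt_trans rk').
Qed.

Let coordinate_sets : set (set (R -> R)) :=
  [set A | exists s (B : set R), [/\ 0 <= s, measurable B & A = [set w | B (w s)]]].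

Lemma measurable_last_zero_event t s : 0 < s < t ->
  path_sigma_algebra (last_zero_event t s).
Proof.
move=> /andP[s0 st].
have t0 : 0 < t by apply: lt_trans st.
rewrite /path_sigma_algebra -/coordinate_sets.
suff : (@measurable _ (g_sigma_algebraType coordinate_sets)) (last_zero_event t s) by [].
have mzero v : 0 <= v -> (@measurable _ (g_sigma_algebraType coordinate_sets)) [set w | w v = 0].
  move=> v0; apply: sub_sigma_algebra; exists v, [set 0]; split => //.
have mrat r : 0 <= r ->
    (@measurable _ (g_sigma_algebraType coordinate_sets)) [set w | has_rat_zero t r w].
  move=> r0; rewrite (_ : [set w | _] = [set w | w t = 0] `|`
     \bigcup_q [set w | r < ratr q < t /\ w (ratr q) = 0]).
    apply: measurableU; first by apply: mzero; exact: ltW.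
    apply: bigcupT_measurable_rat => q.
    have [/andP[rq qt]|nq] := boolP (r < ratr q < t).
      rewrite (_ : [set w | _] = [set w | w (ratr q) = 0]).
        by apply: mzero; rewrite (le_trans r0)// ltW.
      by apply/seteqP; split => [w []//|w /= ->].
    by rewrite (_ : [set w | _] = set0)//; apply/seteqP; split => // w [].
  apply/seteqP; split => w.
    by move=> [wt|[q hq]]; [left|right; exists q].
  by move=> [wt|[q _ hq]]; [left|right; exists q].
apply: measurableI.
  exact: (measurableC (mrat _ (ltW s0))).
apply: bigcapT_measurable => k; apply: mrat.
by rewrite mulr_ge0// ltW.
Qed.

(** * The last zero of the rescaled chain *)

Section scaled_path.
Context (b : nat -> R) (n : nat).
Context (b0 : 0 < b n) (n0 : (0 < n)%N).

Let nR : 0 < n%:R :> R. Proof. by rewrite ltr0n. Qed.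

Let scaled_path_eq0 (z : nat -> nat) (u : R) :
  scaled_path z b n u = 0 <-> z (Num.truncn (n%:R * u)) = 0.
Proof.
rewrite /scaled_path; split => [/eqP|->]; last by rewrite mul0r.
by rewrite mulf_eq0 invr_eq0 (gt_eqF b0) orbF pnatr_eq0 => /eqP.
Qed.

Lemma scaled_path_right_step (z : nat -> nat) : right_step (scaled_path z b n).
Proof.
move=> s s0; rewrite /scaled_path.
have ns0 : 0 <= n%:R * s by rewrite mulr_ge0.
have lt1 : s < (Num.truncn (n%:R * s)).+1%:R / n%:R.
  by rewrite ltr_pdivlMr// mulrC truncnS_gt.
near=> u.
suff -> : Num.truncn (n%:R * u) = Num.truncn (n%:R * s) by [].
have su : s < u by near: u; exact: nbhs_right_gt.
have ul : u < (Num.truncn (n%:R * s)).+1%:R / n%:R by near: u; exact: nbhs_right_lt.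
apply/eqP; rewrite truncn_eq ?mulr_ge0//; last by rewrite (le_trans s0)// ltW.
rewrite (@le_trans _ _ (n%:R * s)) ?truncn_le//=; last by rewrite ler_pM2l// ltW.
by rewrite mulrC -ltr_pdivlMr.
Unshelve. all: by end_near. Qed.

Let truncn_itv (u : R) (j : nat) : j%:R / n%:R <= u < j.+1%:R / n%:R ->
  Num.truncn (n%:R * u) = j.
Proof.
rewrite ler_pdivrMr// ltr_pdivlMr// => /andP[h1 h2].
by apply/eqP; rewrite truncn_eq mulrC ?h1// (le_trans _ h1).
Qed.

(** A visit at time k fills the cell [k/n, (k+1)/n), whose supremum is not in it; hence n s is k + 1
    and not k. *)
Lemma last_zero_scaled_path (z : nat -> nat) (k : nat) t s :
  0 < s < t -> n%:R * s = k.+1%:R ->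
  last_zero t (scaled_path z b n) = s <->
  z k = 0 /\ forall j, (k < j <= Num.truncn (n%:R * t))%N -> z j <> 0.
Proof.
move=> st nsk; have /andP[s0 st'] := st; rewrite last_zeroP//.
have sE : s = k.+1%:R / n%:R by rewrite -nsk mulrC mulKf// gt_eqF.
have t0 : 0 < t by rewrite (lt_trans s0).
have nt0 : 0 <= n%:R * t by rewrite mulr_ge0// ltW.
set N := Num.truncn (n%:R * t).
have Nt : N%:R <= n%:R * t by rewrite truncn_le.
have kN : (k < N)%N.
  rewrite /N truncn_ge_nat// -nsk ler_pM2l// ltW//.
have ks : k%:R / n%:R < s by rewrite sE ltr_pM2r ?invr_gt0// ltr_nat.
have k0 : 0 <= k%:R / n%:R :> R by rewrite divr_ge0.
have itv_k u : k%:R / n%:R <= u -> u < s -> Num.truncn (n%:R * u) = k.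
  by move=> h1 h2; apply: truncn_itv; rewrite h1 -sE.
split=> [[h1 h2]|[zk hz]].
  have hz j : (k < j <= N)%N -> z j <> 0.
    (* The last cell may be cut off by t, so t is its witness. Other cells use their midpoint, since
       for j = k + 1 the left end is s, outside (s, t]. *)
    move=> /andP[kj]; rewrite leq_eqVlt => /predU1P[->|jN] zj.
      by apply: h1; exists t; [rewrite st' lexx|apply/scaled_path_eq0].
    apply: h1; exists ((j%:R + 2^-1) / n%:R).
      apply/andP; split.
        rewrite sE ltr_pM2r ?invr_gt0//.
        have : k.+1%:R <= j%:R :> R by rewrite ler_nat.
        lra.
      rewrite ler_pdivrMr// mulrC; apply: le_trans Nt.
      have : j.+1%:R <= N%:R :> R by rewrite ler_nat.
      rewrite -natr1; lra.
    apply/scaled_path_eq0; rewrite (@truncn_itv _ j)//.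
    have niR : 0 < n%:R^-1 :> R by rewrite invr_gt0.
    rewrite (ler_pM2r niR) (ltr_pM2r niR) -[j.+1%:R]natr1.
    by apply/andP; split; lra.
  split => //.
  have [u /andP[ku ut] /scaled_path_eq0 zu] := h2 (k%:R / n%:R) (introT andP (conj k0 ks)).
  have us : u <= s.
    rewrite leNgt; apply/negP => su; apply: h1; exists u; first by rewrite su.
    exact/scaled_path_eq0.
  move: us; rewrite le_eqVlt => /predU1P[us|us].
    by exfalso; apply: (hz k.+1); rewrite ?leqnn// -zu us nsk natrK.
  by rewrite -zu itv_k// ltW.
split.
  move=> [u /andP[su ut] /scaled_path_eq0]; apply: hz.
  rewrite truncn_ge_nat ?mulr_ge0//; last by rewrite (le_trans (ltW s0))// ltW.
  rewrite -nsk ler_pM2l// (ltW su)/=; apply: le_truncn.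
  by rewrite ler_pM2l.
move=> r /andP[r0 rs].
pose u := (Num.max r (k%:R / n%:R) + s) / 2.
have us : Num.max r (k%:R / n%:R) < s by rewrite gt_max rs.
have r1 : r <= Num.max r (k%:R / n%:R) by rewrite le_max lexx.
have k1 : k%:R / n%:R <= Num.max r (k%:R / n%:R) by rewrite le_max lexx orbT.
exists u; first by rewrite /u; apply/andP; split; lra.
by apply/scaled_path_eq0; rewrite itv_k// /u; lra.
Qed.

End scaled_path.

End last_zero.

Theorem corollary9 (R : realType)
  (mu nu : probability nat R)
  (hmu : mass mu 1 < 1) (hnu : 0 < mass nu 0)
  (c d alpha : R) (l k : R -> R)
  (hSL : assumption_SL mu nu c d alpha l k)
  (delta : R) (hdelta : delta = d / (alpha * c)) (hdelta01 : 0 < delta < 1)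
  (b : nat -> R) (hb : scaling_sequence alpha l b)
  (disp1 : measure_display) (Omega1 : measurableType disp1)
  (P1 : probability Omega1 R) (Z1 : nat -> Omega1 -> nat)
  (hZ1 : is_BGWI P1 mu nu Z1)
  (disp : nat -> measure_display) (Omega : forall n, measurableType (disp n))
  (P : forall n, probability (Omega n) R)
  (Z : forall n, Omega n -> R -> R)
  (hZmeas : forall n, random_path (Z n))
  (hZstep : forall n x, step_path (Z n x))
  (hZlaw : forall n,
     same_law (P n) P1 (Z n) (fun x => scaled_path (fun j => Z1 j x) b n))
  (t : R) (ht : 0 < t) (s_ : nat -> R) (s : R)
  (hs_nat : forall n, exists m : nat, n%:R * s_ n = m%:R)
  (hs_cvg : s_ @ \oo --> s) (hs : 0 < s < t) :
  asymp_equiv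
    (fun n => fine (P n [set x | last_zero t (Z n x) = s_ n]))
    (fun n => n%:R^-1 *
       (Gamma delta * Gamma (1 - delta) *
        s `^ delta * (t - s) `^ (1 - delta))^-1).
Proof.
have /andP[delta0 delta1] := hdelta01; have /andP[s0 st] := hs.
pose u i := \prod_(j < i) genfun nu (iter j (genfun mu) 0).
pose v := escape P1 Z1.
pose m n := Num.truncn (n%:R * s_ n).
(* The time of the last visit, whose cell ends at s_n = m n / n. Eventually m n > 0, so the
   predecessor is a true one. *)
pose i n := (m n).-1.
pose N n := Num.truncn (t * n%:R).
pose j n := (N n - i n)%N.
have mE n : (m n)%:R = n%:R * s_ n.
  by have [q hq] := hs_nat n; rewrite /m hq natrK.
have m_cvg : (fun n => (m n)%:R / n%:R) @ \oo --> s.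
  apply: cvg_trans hs_cvg; apply: near_eq_cvg; near=> n.
  have n0 : 0 < n%:R :> R by rewrite ltr0n; near: n; exact: nbhs_infty_gt.
  by rewrite mE mulrC mulKf// gt_eqF.
have m_gt0 : \forall n \near \oo, (0 < m n)%N.
  near=> n.
  have n0 : 0 < n%:R :> R by rewrite ltr0n; near: n; exact: nbhs_infty_gt.
  have : 0 < (m n)%:R / n%:R :> R by near: n; exact: (cvgr_gt _ m_cvg).
  by rewrite pmulr_lgt0 ?invr_gt0// ltr0n.
have invn_cvg : (fun n => n%:R^-1) @ \oo --> (0 : R).
  by have := @cvg_div_natD R 0 (lexx _); under eq_cvg do rewrite addr0.
have i_cvg : (fun n => (i n)%:R / n%:R) @ \oo --> s.
  have h : (fun n => (m n)%:R / n%:R - n%:R^-1) @ \oo --> s - 0 by exact: cvgB.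
  rewrite subr0 in h; apply: cvg_trans h; apply: near_eq_cvg; near=> n.
  have m0 : (0 < m n)%N by near: n.
  by rewrite /i -[in LHS](prednK m0) -natr1 mulrDl mul1r addrK.
have N_cvg : (fun n => (N n)%:R / n%:R) @ \oo --> t by exact: cvg_truncn_div.
have iN : \forall n \near \oo, (i n <= N n)%N.
  near=> n.
  have n0 : 0 < n%:R :> R by rewrite ltr0n; near: n; exact: nbhs_infty_gt.
  have h1 : (i n)%:R / n%:R < (s + t) / 2.
    by near: n; apply: (cvgr_lt _ i_cvg); lra.
  have h2 : (s + t) / 2 < (N n)%:R / n%:R.
    by near: n; apply: (cvgr_gt _ N_cvg); lra.
  by have := lt_trans h1 h2; rewrite ltr_pM2r ?invr_gt0// ltr_nat => /ltnW.
have j_cvg : (fun n => (j n)%:R / n%:R) @ \oo --> t - s.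
  have h : (fun n => (N n)%:R / n%:R - (i n)%:R / n%:R) @ \oo --> t - s by exact: cvgB.
  apply: cvg_trans h; apply: near_eq_cvg; near=> n.
  by rewrite /j natrB ?mulrBl//; near: n.
have ts0 : 0 < t - s by rewrite subr_gt0.
have key : (fun n => n%:R * (u (i n) * v (j n))) @ \oo -->
    (Gamma delta * Gamma (1 - delta) * s `^ delta * (t - s) `^ (1 - delta))^-1.
  apply: renewal_product_cvg => //.
  - by move=> q; exact: (prod_genfun_iter_gt0 hnu hSL).
  - by move=> q; exact: escape_ge0.
  - by move=> q q'; exact: (escape_dec hZ1).
  - by move=> q; exact: (bgwi_renewal hZ1).
  - by rewrite hdelta; exact: (prod_genfun_iter_ratio hnu hSL).
set K := (_ * _ * _ * _)^-1 in key *.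
have K0 : 0 < K.
  by rewrite invr_gt0 !mulr_gt0 ?powR_gt0// Gamma_gt0// subr_gt0 delta1 gtrBl.
rewrite /asymp_equiv.
have H : (fun n => n%:R * (u (i n) * v (j n)) / K) @ \oo --> (1 : R).
  by rewrite -[X in _ --> X](divff (lt0r_neq0 K0)); exact: cvgMr_tmp.
apply: cvg_trans H; apply: near_eq_cvg; near=> n.
have n0 : (0 < n)%N by near: n; exact: nbhs_infty_gt.
have nR : 0 < n%:R :> R by rewrite ltr0n.
have m0 : (0 < m n)%N by near: n.
have iNn : (i n <= N n)%N by near: n.
have sn0 : 0 < s_ n < t.
  apply/andP; split; near: n.
    exact: (cvgr_gt _ hs_cvg).
  exact: (cvgr_lt _ hs_cvg).
have bn0 := scaling_gt0 hb n.
suff -> : fine (P n [set x | last_zero t (Z n x) = s_ n]) = u (i n) * v (j n).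
  by field; rewrite !gt_eqF.
rewrite -(bgwi_excursion hZ1).
(* On step paths the event is the preimage of a set in the path sigma-algebra, the only sets on
   which [same_law] compares laws. *)
have -> : [set x | last_zero t (Z n x) = s_ n] = Z n @^-1` last_zero_event t (s_ n).
  apply/seteqP; split => x /=; have [hw _] := hZstep n x.
    by move/(last_zero_eventP sn0 hw).
  by move=> h; apply/(last_zero_eventP sn0 hw).
rewrite (hZlaw n); last exact: measurable_last_zero_event.
congr (fine (P1 _)).
have nsk : n%:R * s_ n = (i n).+1%:R by rewrite /i prednK// mE.
have hw x := @scaled_path_right_step R b n n0 (fun q => Z1 q x).
have lzs x := @last_zero_scaled_path R b n bn0 n0 (fun q => Z1 q x) (i n) t (s_ n) sn0 nsk.
rewrite /j subnKC//; apply/seteqP; split => x /=.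
  move=> /(last_zero_eventP sn0 (hw x)) /(lzs x)[h1 h2]; split => // q.
  by rewrite /N mulrC; exact: h2.
move=> [h1 h2]; apply/(last_zero_eventP sn0 (hw x)); apply/(lzs x).
by split => // q; rewrite [n%:R * t]mulrC; exact: h2.
Unshelve. all: by end_near. Qed.
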